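(* There exist constants $\beta_0,D_0>0$ such that for all $\gamma,\delta\in(0,1]$, $\beta\in(0,\beta_0)$ and $C\ge D_0/(\delta^2\sqrt{\beta}\,\gamma)$ there is $n_0=n_0(\gamma,\delta,\beta,C)$ such that for all $n\ge n_0$, writing $\rho:=\sqrt{\beta(\log n)/n}$, the following holds. For every graph $H$ on $n$ vertices there exists a triangle-free subgraph $G\subseteq H$ with $V(G)=V(H)$ such that $$e_G(A,B)=(1\pm\delta)\rho\, e_H(A,B)$$ for all disjoint vertex sets $A,B\subseteq V(H)$ with $|A|=|B|=\lceil C\sqrt{n\log n}\,\rceil$ and $e_H(A,B)\ge\gamma|A||B|$.
   Context: For a graph $F$ and disjoint vertex sets $A,B$, $e_F(A,B)$ denotes the number of edges of $F$ with one endpoint in $A$ and the other in $B$. The notation $x=(1\pm\delta)y$ means $(1-\delta)y\le x\le(1+\delta)y$. *)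

(* Defs.v *)
From mathcomp Require Import all_boot all_order all_algebra.
From mathcomp Require Import reals exp.

Set Implicit Arguments.
Unset Strict Implicit.
Unset Printing Implicit Defensive.

Import Order.TTheory GRing.Theory Num.Theory.

Record sgraph (T : finType) := SGraph {
  adj :> rel T;
  adj_sym : symmetric adj;
  adj_irrefl : irreflexive adj
}.

Definition subgraph (T : finType) (G H : sgraph T) : Prop :=
  forall x y : T, G x y -> H x y.

Definition triangle_free (T : finType) (G : sgraph T) : Prop :=
  ~ exists x y z : T, [/\ G x y, G y z & G x z].

Definition edges (T : finType) (F : sgraph T) : {set {set T}} :=
  [set [set p.1; p.2] | p : T * T & F p.1 p.2].

Definition edges_between (T : finType) (F : sgraph T) (A B : {set T}) : nat :=
  #|[set e in edges F | [exists a in A, exists b in B, e == [set a; b]]]|.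

Local Open Scope ring_scope.

(* x = (1 +- d) y *)
Definition approx_eq (R : realType) (d x y : R) : Prop :=
  (1 - d) * y <= x <= (1 + d) * y.

Definition rho (R : realType) (beta : R) (n : nat) : R :=
  Num.sqrt (beta * ln n%:R / n%:R).

(* Main.v *)
Require Import Defs.
From mathcomp Require Import all_boot all_order all_algebra.
From mathcomp Require Import reals sequences exp.
From mathcomp Require Import ring lra.

Set Implicit Arguments.
Unset Strict Implicit.
Unset Printing Implicit Defensive.

Import Order.TTheory GRing.Theory Num.Theory.
Local Open Scope ring_scope.

(* A discretised, derandomised triangle-free process is run inside [H].  A state
   consists of the chosen edges [E] and of the open pairs [O], initially all of
   [H].  During each of very many short time steps of length [tau], when a
   proportion [q] of the pairs should still be open, every open pair is chosen
   with probability [tau / q]; moreover every open pair is discarded with just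
   the probability that makes its total probability of ceasing to be open equal
   to a constant [eps].  Hence the number of open pairs between two sets divided
   by [q] is a martingale, and the number of chosen edges between them grows at
   the corresponding rate.

   Because of these artificial losses only upper bounds that are sharp up to
   constants are needed for the codegrees (open-open, chosen-open and
   chosen-chosen) that govern the true closing rates: the loss only affects the
   exponent in the final value [n ^ (- 11 * beta)] of [q], which is harmless when
   [beta] is small.

   No probability space is needed.  A sum, over all tracked quantities, of
   exponentials of normalised deviations has nonpositive expected increment, so
   that at each step some action does not increase it, and it stays below 1.
   For the open pairs between [A] and [B] the exponent must be about
   [log n / (delta * gamma * |A|)] per pair.  One action closes at most about
   [m * q] pairs, where [m = n * rho], and the lower bound on [C] makes the
   resulting jump of the exponent at most [(log n) / 40].  Jumps larger than a
   small multiple of [1 / log n] come from the few vertices with many neighbours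
   in [A] or [B], and contribute a negligible amount in total. *)

(** * Choosing an action that does not increase a potential *)

Section WeightedChoice.
Variables (R : realType) (I : finType).
Implicit Types (P y : I -> R).

(** [1 - x <= expR (- x)] gives [expR x - 1 <= x * expR x], so the second-order remainder is at most
    [x * (expR x - 1)], and [expR x - 1] is again of order [x]. *)
Lemma expR_le_quadratic (x : R) : expR x <= 1 + x + x ^+ 2 * expR `|x|.
Proof.
have hx := expR_ge1Dx (- x); have hx' := expR_ge1Dx x.
have hp := expR_gt0 x; have hE := expRxMexpNx_1 x.
have h1 : expR x - 1 <= x * expR x.
  have: (1 - x) * expR x <= expR (- x) * expR x by rewrite ler_pM2r.
  by rewrite (mulrC (expR (- x))) hE; nra.
have [x0|x0] := lerP 0 x; first by rewrite ger0_norm //; nra.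
have ha : 1 <= expR `|x| by rewrite -expR0 ler_expR.
by nra.
Qed.

(** One step of an exponential supermartingale. The idle weight [1 - \sum_a P a] sees only the
    deterministic change [c]; the mean condition cancels the first-order terms and [om] pays for the
    second-order ones. *)
Lemma mgf_step P y (c om : R) : (forall a, 0 <= P a) -> \sum_a P a <= 1 ->
  \sum_a P a * y a + c <= 0 ->
  \sum_a P a * (y a ^+ 2 * expR `|y a|) <= om ->
  (1 - \sum_a P a) * expR (c - om) + \sum_a P a * expR (y a + c - om) <= 1.
Proof.
move=> P0 P1 hy hq.
have -> : \sum_a P a * expR (y a + c - om)
    = (\sum_a P a * expR (y a)) * expR (c - om).
  by rewrite big_distrl /=; apply: eq_bigr => a _; rewrite -addrA (expRD (y a)) mulrA.
rewrite -mulrDl.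
have h1 : 1 - \sum_a P a + \sum_a P a * expR (y a) <= 1 + (- c + om).
  have : \sum_a P a * expR (y a) <=
      \sum_a P a + \sum_a P a * y a + \sum_a P a * (y a ^+ 2 * expR `|y a|).
    rewrite -!big_split /=; apply: ler_sum => a _.
    have := ler_wpM2l (P0 a) (expR_le_quadratic (y a)); lra.
  lra.
have h2 := expR_ge1Dx (- c + om).
have h3 : expR (- c + om) * expR (c - om) = 1.
  by rewrite -expRD (_ : _ + _ = 0) ?expR0 //; ring.
rewrite -h3 ler_pM2r ?expR_gt0 //; lra.
Qed.

(** The returned action has positive weight, so it can really be performed. If idling and all such
    actions gave more than [F], so would the weighted mean; total weight 1 is treated apart, since
    idling then counts for nothing. *)
Lemma averaging P (f : I -> R) (f0 F : R) : (forall a, 0 <= P a) ->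
  \sum_a P a <= 1 -> (1 - \sum_a P a) * f0 + \sum_a P a * f a <= F ->
  f0 <= F \/ exists2 a, 0 < P a & f a <= F.
Proof.
move=> P0 P1 h.
have [|f0F] := lerP f0 F; [by left | right].
have [/existsP[a /andP[? ?]]|] := boolP [exists a, (0 < P a) && (f a <= F)].
  by exists a.
rewrite negb_exists => /forallP hn.
have hle a : P a * F <= P a * f a.
  have := hn a; rewrite negb_and -leNgt -ltNge => /orP[Pa|Fa].
    have -> : P a = 0 by apply/le_anti; rewrite Pa P0.
    by rewrite !mul0r.
  by rewrite ler_wpM2l // ltW.
have hs : (\sum_a P a) * F <= \sum_a P a * f a.
  by rewrite big_distrl; apply: ler_sum => a _; exact: hle.
have [Ps|Ps] := ltrP (\sum_a P a) 1.
  by exfalso; nra.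
have {Ps} Ps : \sum_a P a = 1 by apply/le_anti; rewrite P1.
have heq : \sum_a (P a * f a - P a * F) = 0.
  apply/le_anti/andP; split; last by apply: sumr_ge0 => a _; rewrite subr_ge0.
  rewrite sumrB -big_distrl /= Ps; move: h; rewrite Ps; lra.
have hz a : P a * f a - P a * F = 0.
  have h0 b : true -> 0 <= P b * f b - P b * F by rewrite subr_ge0.
  by have /eqP := heq; rewrite psumr_eq0 // => /allP/(_ a (mem_index_enum a))/eqP.
have [a Pa] : exists a, 0 < P a.
  have [/existsP//|] := boolP [exists a, 0 < P a].
  rewrite negb_exists => /forallP hPn.
  have : \sum_a P a = 0.
    apply: big1 => a _; apply/le_anti; rewrite P0 andbT leNgt; exact: hPn.
  by rewrite Ps => /eqP; rewrite oner_eq0.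
exists a => //; have := hz a; move: Pa; nra.
Qed.

End WeightedChoice.

(* With the remaining weight [1 - \sum_a P i S a] nothing happens at step [i];
   then only the time-dependent part of [V] changes, hence the terms
   [V k i.+1 S - V k i S] below. *)
Section Derandomization.
Variables (R : realType) (St : Type) (Act K : finType).
Variables (Inv : St -> Prop) (next : St -> Act -> St) (P : nat -> St -> Act -> R).
Variables (ok : pred K) (V : K -> nat -> St -> R) (S0 : St).
Variables (lam drift om B : K -> R) (N : nat).

(** The exponent of one summand of the potential: the deviation from initial value plus drift,
    scaled by [lam], minus a starting budget [B] and the accumulated second-order cost. *)
Definition pot k i S :=
  lam k * (V k i S - V k 0 S0 - drift k * i%:R) - B k - om k * i%:R.

Hypothesis Inv0 : Inv S0.
Hypothesis lam_ge0 : forall k, ok k -> 0 <= lam k.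
Hypothesis B_small : \sum_(k | ok k) expR (- B k) < 1.

Definition confined i S := forall k, ok k -> pot k i S < 0.

Hypothesis P_ge0 : forall i S, (i < N)%N -> Inv S -> confined i S ->
  forall a, 0 <= P i S a.
Hypothesis P_le1 : forall i S, (i < N)%N -> Inv S -> confined i S ->
  \sum_a P i S a <= 1.
Hypothesis Inv_next : forall i S a, (i < N)%N -> Inv S -> 0 < P i S a ->
  Inv (next S a).
Hypothesis controlled : forall i S k, (i < N)%N -> Inv S -> confined i S ->
  ok k -> exists y : Act -> R,
  [/\ forall a, 0 < P i S a -> V k i.+1 (next S a) - V k i.+1 S <= y a,
      \sum_a P i S a * y a + (V k i.+1 S - V k i S) <= drift k &
      \sum_a P i S a * ((lam k * y a) ^+ 2 * expR `|lam k * y a|) <= om k].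

Lemma process_step i S : (i < N)%N -> Inv S ->
  \sum_(k | ok k) expR (pot k i S) < 1 ->
  exists S', Inv S' /\ \sum_(k | ok k) expR (pot k i.+1 S') < 1.
Proof.
move=> iN IS Phi1.
(* No summand exceeds the sum, so a potential below 1 makes every exponent negative; this
   confinement licenses the hypotheses on weights and increments. *)
have conf : confined i S.
  move=> k okk; rewrite ltNge; apply/negP => h.
  have : 1 <= \sum_(k | ok k) expR (pot k i S).
    rewrite (bigD1 k) //= -[1]addr0; apply: lerD.
      by rewrite -expR0 ler_expR.
    by apply: sumr_ge0 => j _; exact: expR_ge0.
  by rewrite leNgt Phi1.
set p := P i S; set p0 := 1 - \sum_a p a.
have p_ge0 a : 0 <= p a := P_ge0 iN IS conf a; have p_le1 := P_le1 iN IS conf.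
pose F S' := \sum_(k | ok k) expR (pot k i.+1 S').
(* The weighted mean of the next potential is at most the present one: [mgf_step] is applied to each
   summand. *)
have main : p0 * F S + \sum_a p a * F (next S a)
    <= \sum_(k | ok k) expR (pot k i S).
  have -> : \sum_a p a * F (next S a) =
      \sum_(k | ok k) \sum_a p a * expR (pot k i.+1 (next S a)).
    by rewrite exchange_big /=; apply: eq_bigr => a _; rewrite /F big_distrr.
  rewrite /F big_distrr /= -big_split /=; apply: ler_sum => k okk.
  have [y [hy hm hq]] := controlled iN IS conf okk.
  set c := lam k * (V k i.+1 S - V k i S - drift k).
  have e0 : pot k i.+1 S = pot k i S + (c - om k).
    by rewrite /pot /c -natr1; ring.
  have ea a : 0 < p a ->
      pot k i.+1 (next S a) <= pot k i S + (lam k * y a + c - om k).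
    move=> pa; have h := ler_wpM2l (lam_ge0 okk) (hy a pa).
    have -> : pot k i.+1 (next S a) = pot k i.+1 S
        + lam k * (V k i.+1 (next S a) - V k i.+1 S) by rewrite /pot; ring.
    by rewrite e0; lra.
  have hmean : \sum_a p a * (lam k * y a) + c <= 0.
    have -> : \sum_a p a * (lam k * y a) = lam k * \sum_a p a * y a.
      by rewrite big_distrr; apply: eq_bigr => a _; rewrite mulrCA.
    rewrite /c; have := lam_ge0 okk; nra.
  have /(ler_wpM2l (expR_ge0 (pot k i S))) := mgf_step p_ge0 p_le1 hmean hq.
  rewrite mulr1; apply: le_trans.
  rewrite mulrDr; apply: lerD; first by rewrite e0 (expRD (pot k i S)) mulrCA lexx.
  rewrite big_distrr; apply: ler_sum => a _ /=.
  rewrite mulrCA -expRD -/p.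
  have := p_ge0 a; rewrite le_eqVlt => /orP[/eqP <-|pa]; first by rewrite !mul0r.
  by apply: ler_wpM2l; [exact: ltW | rewrite ler_expR ea].
case: (averaging p_ge0 p_le1 main) => [h|[a pa h]].
  by exists S; split=> //; exact: le_lt_trans h _.
by exists (next S a); split; [exact: Inv_next iN IS pa|exact: le_lt_trans h _].
Qed.

Lemma process_end : exists S, Inv S /\ confined N S.
Proof.
suff h i : (i <= N)%N ->
    exists S, Inv S /\ \sum_(k | ok k) expR (pot k i S) < 1.
  have [S [IS PS]] := h _ (leqnn N); exists S; split=> // k okk.
  rewrite ltNge; apply/negP => hk.
  have : 1 <= \sum_(k | ok k) expR (pot k N S).
    rewrite (bigD1 k) //= -[1]addr0; apply: lerD; first by rewrite -expR0 ler_expR.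
    by apply: sumr_ge0 => j _; exact: expR_ge0.
  by rewrite leNgt PS.
elim: i => [_|i IH iN]; last first.
  by have [S [IS PS]] := IH (ltnW iN); apply: (process_step iN IS PS).
exists S0; split=> //; apply: le_lt_trans B_small; apply: ler_sum => k _.
by rewrite ler_expR /pot !mulr0 !subr0 subrr mulr0 sub0r.
Qed.

Lemma confined_le k i S : ok k -> 0 < lam k -> confined i S ->
  V k i S <= V k 0 S0 + drift k * i%:R + (B k + om k * i%:R) / lam k.
Proof.
move=> okk lk /(_ k okk); rewrite /pot => h.
have -> : V k 0 S0 + drift k * i%:R + (B k + om k * i%:R) / lam k =
  V k i S - (lam k * (V k i S - V k 0 S0 - drift k * i%:R) - B k - om k * i%:R) / lam k.
  by field; rewrite gt_eqF.
by rewrite lerBrDr gerDl pmulr_lle0 ?invr_gt0 // ltW.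
Qed.

End Derandomization.

(** * Indicators as real numbers *)

Section Indicators.
Variable R : realType.

Lemma ind_le1 (b : bool) : b%:R <= 1 :> R.
Proof. by case: b. Qed.

Lemma ind_and (b c : bool) : (b && c)%:R = b%:R * c%:R :> R.
Proof. by rewrite -mulnb natrM. Qed.

Lemma ind_imp (b c : bool) : (b -> c) -> b%:R <= c%:R :> R.
Proof. by case: b => [->|_] //; exact: ler0n. Qed.

Lemma ind_or_le (b c : bool) : (b || c)%:R <= b%:R + c%:R :> R.
Proof. by case: b; case: c; rewrite /= ?addr0 ?add0r ?lerDl ?ler01. Qed.

Lemma ind_exists_le (I : finType) (q : pred I) :
  [exists i, q i]%:R <= \sum_i (q i)%:R :> R.
Proof.
case: existsP => [[i qi]|_]; last by apply: sumr_ge0 => i _; exact: ler0n.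
by rewrite (bigD1 i) //= qi lerDl; apply: sumr_ge0 => j _; exact: ler0n.
Qed.

Lemma sum_ind_eq (I : finType) (i : I) (f : I -> R) :
  \sum_j (j == i)%:R * f j = f i.
Proof.
rewrite (bigD1 i) //= eqxx mul1r big1 ?addr0 // => j /negbTE ->.
by rewrite mul0r.
Qed.

Lemma sum_ind_mem (I : finType) (A : {set I}) :
  \sum_i (i \in A)%:R = #|A|%:R :> R.
Proof.
rewrite -sum1_card natr_sum [RHS]big_mkcond; apply: eq_bigr => i _.
by case: (i \in A).
Qed.

End Indicators.

(** * States of the process *)

Section Process.
Variables (R : realType) (T : finType) (H : sgraph T).

Definition same (e : T * T) (u v : T) :=
  ((u == e.1) && (v == e.2)) || ((u == e.2) && (v == e.1)).

Lemma sameC e u v : same e u v = same e v u.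
Proof. by rewrite /same orbC andbC [X in _ || X]andbC. Qed.

(* A state is a pair (E, O): the edges chosen so far and the pairs that are
   still open, i.e. may be chosen later without creating a triangle. *)
Definition state := (rel T * rel T)%type.

Definition add_edges (S : state) e : rel T := fun u v => S.1 u v || same e u v.

Definition add (S : state) e : state :=
  (add_edges S e, fun u v => [&& S.2 u v, ~~ add_edges S e u v &
     ~~ [exists w, add_edges S e u w && add_edges S e w v]]).

Definition kill (S : state) e : state :=
  (S.1, fun u v => S.2 u v && ~~ same e u v).

Definition act := (bool * (T * T))%type.

Definition perform (S : state) (a : act) : state :=
  if a.1 then add S a.2 else kill S a.2.

Definition lost (S : state) (a : act) u v := S.2 u v && ~~ (perform S a).2 u v.

Record valid (S : state) : Prop := Valid {
  valid_Esym : symmetric S.1;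
  valid_Osym : symmetric S.2;
  valid_EH : subrel S.1 H;
  valid_OH : subrel S.2 H;
  valid_disj : forall u v, S.2 u v -> S.1 u v -> False;
  valid_open : forall u w v, S.2 u v -> S.1 u w -> S.1 w v -> False;
  valid_free : forall u w v, S.1 u v -> S.1 u w -> S.1 w v -> False }.

Lemma valid_start : valid (fun _ _ => false, adj H).
Proof. by split=> //; exact: adj_sym. Qed.

Section FixedState.
Variable S : state.
Hypothesis IS : valid S.

Lemma valid_Eirr u : S.1 u u = false.
Proof. by apply/negP => /(valid_EH IS); rewrite adj_irrefl. Qed.

Lemma valid_Oirr u : S.2 u u = false.
Proof. by apply/negP => /(valid_OH IS); rewrite adj_irrefl. Qed.

Lemma same_neq e u v : S.2 e.1 e.2 -> same e u v -> u != v.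
Proof.
move=> Oe; apply: contraTneq => ->; rewrite /same andbC orbb.
by apply/negP => /andP[/eqP e2 /eqP e1]; move: Oe; rewrite -e1 -e2 valid_Oirr.
Qed.

Lemma same_O e u v : S.2 e.1 e.2 -> same e u v -> S.2 u v.
Proof.
move=> Oe /orP[] /andP[/eqP-> /eqP->] //; by rewrite (valid_Osym IS).
Qed.

Lemma add_edges_sym e : symmetric (add_edges S e).
Proof. by move=> u v; rewrite /add_edges (valid_Esym IS) sameC. Qed.

(** A path of length two that used the single new edge twice would return to its start. *)
Lemma add_edges_path e u w v : S.2 e.1 e.2 -> u != v ->
  add_edges S e u w -> add_edges S e w v ->
  [\/ S.1 u w /\ S.1 w v, S.1 u w /\ same e w v | same e u w /\ S.1 w v].
Proof.
move=> Oe uv /orP[Eu|su] /orP[Ev|sv]; 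
  [by constructor 1|by constructor 2|by constructor 3|].
exfalso; have n1 := same_neq Oe su; have n2 := same_neq Oe sv.
move: n1 n2 uv su sv.
rewrite /same => /eqP n1 /eqP n2 /eqP n3.
by move=> /orP[]/andP[/eqP a /eqP b] /orP[]/andP[/eqP c /eqP d]; congruence.
Qed.

(** A triangle of the enlarged graph would contain the new edge exactly once; its other two sides
    would be old edges joining the ends of an open pair, contrary to [valid_open]. *)
Lemma valid_add e : S.2 e.1 e.2 -> valid (add S e).
Proof.
move=> Oe; split => /=.
- exact: add_edges_sym.
- move=> u v /=; rewrite (valid_Osym IS) add_edges_sym.
  congr [&& _, _ & ~~ _]; apply: eq_existsb => w.
  by rewrite andbC add_edges_sym [add_edges S e u w]add_edges_sym.
- by move=> u v /orP[/(valid_EH IS)//|/(same_O Oe)/(valid_OH IS)].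
- by move=> u v /and3P[/(valid_OH IS)].
- by move=> u v /and3P[_ /negP].
- move=> u w v /and3P[_ _ /existsPn/(_ w)/negP h] h1 h2; apply: h.
  by rewrite h1 h2.
move=> u w v huv hu hv.
have uv : u != v.
  apply: contraTneq huv => ->; rewrite negb_or valid_Eirr /=.
  by apply/negP => /(same_neq Oe); rewrite eqxx.
case: (add_edges_path Oe uv hu hv) => [[h1 h2]|[h1 h2]|[h1 h2]].
- case/orP: huv => h; first exact: (valid_free IS h h1 h2).
  exact: (valid_open IS (same_O Oe h) h1 h2).
- case/orP: huv => h; last first.
    move: h1; have -> : w = u; last by rewrite valid_Eirr.
    move: uv; have := same_neq Oe h2; move: h h2; rewrite /same.
    move=> /orP[]/andP[/eqP a /eqP b] /orP[]/andP[/eqP c /eqP d] /eqP ? /eqP ?;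
  congruence.
  by apply: (valid_open IS (same_O Oe h2) _ h); rewrite (valid_Esym IS).
case/orP: huv => h; last first.
  move: h2; have -> : w = v; last by rewrite valid_Eirr.
  move: uv; have := same_neq Oe h1; move: h h1; rewrite /same.
  move=> /orP[]/andP[/eqP a /eqP b] /orP[]/andP[/eqP c /eqP d] /eqP ? /eqP ?;
  congruence.
by apply: (valid_open IS (same_O Oe h1) h); rewrite (valid_Esym IS).
Qed.

Lemma valid_kill e : valid (kill S e).
Proof.
case: IS => h1 h2 h3 h4 h5 h6 h7; split => //=.
- by move=> u v /=; rewrite h2 sameC.
- by move=> u v /andP[/h4].
- by move=> u v /andP[/h5].
by move=> u w v /andP[/h6 h _]; exact: h.
Qed.

Lemma valid_perform a : S.2 a.2.1 a.2.2 -> valid (perform S a).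
Proof. by case: a => [[] e] /= Oe; [exact: valid_add|exact: valid_kill]. Qed.

Lemma perform_O a u v : (perform S a).2 u v = S.2 u v && ~~ lost S a u v.
Proof.
rewrite /lost; case: a => [[] e] /=; case: (S.2 u v) => //=;
  by apply/esym/negbK.
Qed.

Lemma lostC a u v : lost S a u v = lost S a v u.
Proof.
rewrite /lost (valid_Osym IS); case E : (S.2 v u) => //=.
have [Oe|] := boolP (S.2 a.2.1 a.2.2).
  by rewrite (valid_Osym (valid_perform Oe)).
case: a => [[] e] /= _; rewrite (valid_Osym IS) E /=; last by rewrite sameC.
rewrite add_edges_sym; congr (~~ (_ && ~~ _)); apply: eq_existsb => w.
by rewrite andbC add_edges_sym [add_edges S e u w]add_edges_sym.
Qed.

(** No open pair of a valid state is joined by two old edges, so a pair closed by adding [e] is [e]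
    itself or is joined by a path made of [e] and one old edge. *)
Lemma lost_addP e u v : S.2 e.1 e.2 -> lost S (true, e) u v ->
  [\/ same e u v, exists2 z, same e u z & S.1 z v |
      exists2 z, S.1 u z & same e z v].
Proof.
move=> Oe /andP[Ouv]; rewrite /= Ouv /= negb_and !negbK.
have uv : u != v by apply: contraTneq Ouv => ->; rewrite valid_Oirr.
case/orP => [/orP[/(valid_disj IS Ouv)//|s]|/existsP[w /andP[hu hv]]].
  by constructor 1.
case: (add_edges_path Oe uv hu hv) => [[h1 h2]|[h1 h2]|[h1 h2]].
- by case: (valid_open IS Ouv h1 h2).
- by constructor 3; exists w.
by constructor 2; exists w.
Qed.

Lemma lost_kill e u v : lost S (false, e) u v = S.2 u v && same e u v.
Proof. by rewrite /lost /=; case: (S.2 u v) => //=; rewrite negbK. Qed.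

Lemma lost_add_le e u v : S.2 e.1 e.2 ->
  (lost S (true, e) u v)%:R <= (S.2 u v)%:R * ((same e u v)%:R
    + \sum_z (same e u z)%:R * (S.1 z v)%:R
    + \sum_z (S.1 u z)%:R * (same e z v)%:R) :> R.
Proof.
move=> Oe; case h : (lost S (true, e) u v); last first.
  apply: mulr_ge0; first exact: ler0n.
  by rewrite !addr_ge0 ?ler0n // sumr_ge0 // => z _; rewrite mulr_ge0 ?ler0n.
have -> : S.2 u v by case/andP: h.
rewrite mul1r; case: (lost_addP Oe h) => [->|[z h1 h2]|[z h1 h2]].
- by rewrite -addrA lerDl addr_ge0 // sumr_ge0 // => z _; rewrite mulr_ge0 ?ler0n.
- rewrite (bigD1 z) //= h1 h2 mulr1 -addrA addrCA -addrA lerDl.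
  by rewrite !addr_ge0 ?ler0n // sumr_ge0 // => t _; rewrite mulr_ge0 ?ler0n.
rewrite [X in _ <= _ + X](bigD1 z) //= h1 h2 mulr1 addrCA lerDl.
by rewrite !addr_ge0 ?ler0n // sumr_ge0 // => t _; rewrite mulr_ge0 ?ler0n.
Qed.

Lemma sum_same u v :
  \sum_e (S.2 e.1 e.2)%:R * (same e u v)%:R = 2 * (S.2 u v)%:R :> R.
Proof.
have [->|uv] := eqVneq u v.
  rewrite valid_Oirr mulr0 big1 // => e _.
  case Oe : (S.2 e.1 e.2); last by rewrite mul0r.
  case se : (same e v v); last by rewrite mulr0.
  by have := same_neq Oe se; rewrite eqxx.
have sE e : (same e u v)%:R = (e == (u, v))%:R + (e == (v, u))%:R :> R.
  case: e => x y; rewrite /same -!pair_eqE /pair_eq /= (eq_sym u x) (eq_sym v y).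
  rewrite (eq_sym u y) (eq_sym v x) [X in _ || X]andbC.
  have [->|] := eqVneq x u; have [->|] := eqVneq y v;
    rewrite ?(negbTE uv) ?(eq_sym v u) ?(negbTE uv) /= ?addr0 ?add0r //.
under eq_bigr => e _ do rewrite sE mulrC mulrDl.
rewrite big_split /= (sum_ind_eq (u, v) (fun e => (S.2 e.1 e.2)%:R)).
rewrite (sum_ind_eq (v, u) (fun e => (S.2 e.1 e.2)%:R)) /=.
by rewrite (valid_Osym IS v u) mulr_natl mulr2n.
Qed.

End FixedState.

Lemma sum_same_r e u : \sum_z (same e u z)%:R <= (u == e.1)%:R + (u == e.2)%:R :> R.
Proof.
have h z : (same e u z)%:R <=
    (z == e.2)%:R * (u == e.1)%:R + (z == e.1)%:R * (u == e.2)%:R :> R.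
  by apply: le_trans (ind_or_le _ _ _) _; rewrite !ind_and mulrC [X in _ + X <= _]mulrC.
apply: le_trans (ler_sum _ (fun z _ => h z)) _.
by rewrite big_split /= !sum_ind_eq.
Qed.

Lemma sum_same_r2 e u : \sum_z (same e u z)%:R <= 2 :> R.
Proof.
apply: le_trans (sum_same_r _ _) _.
have := ind_le1 R (u == e.1); have := ind_le1 R (u == e.2); lra.
Qed.

Lemma sum_same_all e : \sum_u \sum_z (same e u z)%:R <= 2 :> R.
Proof.
apply: le_trans (ler_sum _ (fun u _ => sum_same_r e u)) _.
rewrite big_split /= -[X in X + _](eq_bigr _ (fun i _ => mulr1 _)).
rewrite -[X in _ + X](eq_bigr _ (fun i _ => mulr1 _)) !sum_ind_eq; lra.
Qed.

Lemma sum_same_e u v : \sum_e (same e u v)%:R <= 2 :> R.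
Proof.
have h e : (same e u v)%:R <= (e == (u, v))%:R * 1 + (e == (v, u))%:R * 1 :> R.
  case: e => x y; apply: le_trans (ind_or_le _ _ _) _; rewrite !mulr1.
  rewrite -!pair_eqE /pair_eq /= (eq_sym u x) (eq_sym v y) (eq_sym u y).
  by rewrite (eq_sym v x) (andbC (y == u)).
apply: le_trans (ler_sum _ (fun e _ => h e)) _.
by rewrite big_split /= !sum_ind_eq; lra.
Qed.

End Process.

Lemma expR1_le4 (R : realType) : expR 1 <= 4 :> R.
Proof.
have h := expR_ge1Dx (- 2^-1 : R); have hE := expRxMexpNx_1 (2^-1 : R).
have -> : (1 : R) = 2^-1 + 2^-1 by field.
rewrite expRD; have := expR_gt0 (2^-1 : R); nra.
Qed.

Lemma quadratic_le (R : realType) (I : finType) (P y g : I -> R) (lam th : R) :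
  (forall a, 0 <= P a) -> 0 <= lam -> th <= 1 ->
  (forall a, 0 < P a -> `|y a| <= g a) ->
  (forall a, 0 < P a -> lam * g a <= th) ->
  \sum_a P a * ((lam * y a) ^+ 2 * expR `|lam * y a|) <=
  4 * th * (lam * \sum_a P a * g a).
Proof.
move=> P0 l0 t1 yg gt; rewrite !big_distrr /=; apply: ler_sum => a _.
have := P0 a; rewrite le_eqVlt => /orP[/eqP<-|Pa]; first by rewrite !mul0r !mulr0.
have h1 : `|lam * y a| <= lam * g a.
  by rewrite normrM (ger0_norm l0) ler_wpM2l // yg.
have h2 := gt a Pa.
have he : expR `|lam * y a| <= 4.
  by apply: le_trans (expR1_le4 R); rewrite ler_expR; lra.
have e0 := expR_gt0 `|lam * y a|.
have hs : (lam * y a) ^+ 2 <= th * (lam * g a).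
  rewrite -real_normK ?num_real // expr2.
  apply: ler_pM => //; exact: le_trans h1 h2.
have s0 : 0 <= (lam * y a) ^+ 2 by exact: sqr_ge0.
have -> : 4 * th * (lam * (P a * g a)) = P a * (th * (lam * g a) * 4) by ring.
by rewrite ler_pM2l //; apply: ler_pM => //; exact: ltW.
Qed.

Lemma sum_act (R : realType) (T : finType) (F : act T -> R) :
  \sum_a F a = \sum_e F (true, e) + \sum_e F (false, e).
Proof.
rewrite (eq_bigr (fun a => F (a.1, a.2))); last by case.
by rewrite -(pair_bigA _ (fun b e => F (b, e))) big_bool.
Qed.

(** * Expected change of the tracked quantities *)

Section Weights.
Variables (R : realType) (T : finType) (H : sgraph T) (p eps : R).
Local Notation state := (state T).
Local Notation act := (act T).

Definition codeg (A B : rel T) u v : R := \sum_w (A u w)%:R * (B v w)%:R.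

(** Counts ordered pairs, so that increments are sums of indicators; [edges_betweenE] links it to
    [edges_between] for disjoint sets. *)
Definition between (A : rel T) (X Y : {set T}) : R :=
  \sum_(a in X) \sum_(b in Y) (A a b)%:R.

Definition closing (S : state) u v : R :=
  \sum_e (S.2 e.1 e.2)%:R * (lost S (true, e) u v)%:R.

(* Discarding [e] with this weight makes an open pair cease to be open with
   total weight exactly [eps], see [sum_weight_lost]; the division by 2 is
   there because both orientations of a pair are actions. *)
Definition kill_weight (S : state) e := (eps - p * closing S e.1 e.2) / 2.

Definition weight (S : state) (a : act) : R :=
  (S.2 a.2.1 a.2.2)%:R * (if a.1 then p else kill_weight S a.2).

Lemma codeg_ge0 A B u v : 0 <= codeg A B u v.
Proof. by apply: sumr_ge0 => w _; rewrite mulr_ge0 ?ler0n. Qed.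

Variable S : state.
Hypothesis IS : valid H S.

Lemma sum_weight_ind u v (c : R) :
  \sum_e (S.2 e.1 e.2)%:R * (c * (same e u v)%:R) = 2 * c * (S.2 u v)%:R.
Proof.
under eq_bigr => e _ do rewrite mulrCA.
by rewrite -big_distrr /= (sum_same R IS); ring.
Qed.

(** By [lost_addP], [uv] is closed by its own addition or by an open pair joining one end to a
    chosen neighbour of the other. The factors 2 count orientations. *)
Lemma closing_le u v :
  closing S u v <= 2 + 2 * codeg S.1 S.2 u v + 2 * codeg S.1 S.2 v u.
Proof.
have h e : (S.2 e.1 e.2)%:R * (lost S (true, e) u v)%:R <=
    (S.2 e.1 e.2)%:R * (1 * (same e u v)%:R)
    + \sum_z (S.2 e.1 e.2)%:R * ((S.1 u z)%:R * (same e v z)%:R)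
    + \sum_z (S.2 e.1 e.2)%:R * ((S.1 v z)%:R * (same e u z)%:R) :> R.
  case Oe : (S.2 e.1 e.2); last first.
    by rewrite !mul0r !big1 ?addr0 // => z _; rewrite mul0r.
  rewrite !mul1r; apply: le_trans (lost_add_le R IS _ _ Oe) _.
  apply: le_trans (ler_piMl _ (ind_le1 _ _)) _.
    by rewrite !addr_ge0 ?ler0n // sumr_ge0 // => z _; rewrite mulr_ge0 ?ler0n.
  rewrite -!addrA lerD2l addrC; apply: lerD; apply: ler_sum => z _.
    by rewrite mul1r (sameC e z).
  by rewrite mul1r mulrC (valid_Esym IS z).
apply: le_trans (ler_sum _ (fun e _ => h e)) _.
rewrite !big_split /= exchange_big [X in _ + X <= _]exchange_big /=.
rewrite sum_weight_ind; apply: lerD; first apply: lerD.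
- have := ind_le1 R (S.2 u v); lra.
- rewrite big_distrr; apply: ler_sum => z _ /=.
  by rewrite sum_weight_ind -mulrA.
rewrite big_distrr; apply: ler_sum => z _ /=.
by rewrite sum_weight_ind -mulrA.
Qed.

Lemma sum_weight_add (f : T * T -> R) :
  \sum_a weight S a * (if a.1 then f a.2 else 0) =
  p * \sum_e (S.2 e.1 e.2)%:R * f e.
Proof.
rewrite sum_act /= [X in _ + X]big1 ?addr0; last by move=> e _; rewrite mulr0.
by rewrite big_distrr; apply: eq_bigr => e _; rewrite /weight /=; ring.
Qed.

Lemma sum_weight_lost u v :
  \sum_a weight S a * (lost S a u v)%:R = eps * (S.2 u v)%:R.
Proof.
case Ouv : (S.2 u v); last first.
  rewrite mulr0 big1 // => a _; rewrite /lost Ouv /= mulr0 //.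
rewrite sum_act.
have -> : \sum_e weight S (true, e) * (lost S (true, e) u v)%:R
    = p * closing S u v.
  by rewrite big_distrr; apply: eq_bigr => e _; rewrite /weight /=; ring.
have -> : \sum_e weight S (false, e) * (lost S (false, e) u v)%:R
    = \sum_e (S.2 e.1 e.2)%:R * (kill_weight S (u, v) * (same e u v)%:R).
  apply: eq_bigr => e _; rewrite lost_kill Ouv /weight /= -mulrA.
  case se : (same e u v); last by rewrite !mulr0.
  congr (_ * (_ * _)); rewrite /kill_weight /=.
  have [/andP[/eqP<- /eqP<-]//|/andP[/eqP<- /eqP<-]] := orP se.
  congr ((_ - _ * _) / _); apply: eq_bigr => e' _.
  by rewrite (lostC IS).
by rewrite sum_weight_ind Ouv /kill_weight /=; field.
Qed.

Lemma sum_weight_lost_sum (I : finType) (Q : pred I) (phi : I -> R) (f g : I -> T) :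
  \sum_a weight S a * \sum_(i | Q i) phi i * (lost S a (f i) (g i))%:R =
  eps * \sum_(i | Q i) phi i * (S.2 (f i) (g i))%:R.
Proof.
under eq_bigr => a _ do rewrite big_distrr.
rewrite exchange_big big_distrr; apply: eq_bigr => i _ /=.
rewrite mulrCA -sum_weight_lost big_distrr; apply: eq_bigr => a _ /=; ring.
Qed.

Hypothesis p_ge0 : 0 <= p.
Variable y : R.
Hypothesis codeg_y : forall u v, u != v -> codeg S.1 S.2 u v <= y.
Hypothesis p_eps : p * (2 + 4 * y) <= eps.

Lemma kill_weight_ge0 e : S.2 e.1 e.2 -> 0 <= kill_weight S e.
Proof.
move=> Oe; apply: divr_ge0 => //; rewrite subr_ge0.
apply: le_trans p_eps; apply: ler_wpM2l => //.
apply: le_trans (closing_le _ _) _.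
have ne : e.1 != e.2 by apply: contraTneq Oe => ->; rewrite (valid_Oirr IS).
have := codeg_y ne; have := codeg_y (contra_neq esym ne); lra.
Qed.

Lemma weight_ge0 a : 0 <= weight S a.
Proof.
rewrite /weight; case Oe : (S.2 a.2.1 a.2.2); last by rewrite mul0r.
by rewrite mul1r; case: a.1 => //; exact: kill_weight_ge0.
Qed.

Lemma weight_gt0_O a : 0 < weight S a -> S.2 a.2.1 a.2.2.
Proof. by rewrite /weight; case: (S.2 _ _) => //; rewrite mul0r ltxx. Qed.

Lemma sum_weight_le1 : 0 <= eps -> #|T|%:R ^+ 2 * (p + eps) <= 1 ->
  \sum_a weight S a <= 1.
Proof.
move=> e0; apply: le_trans; rewrite sum_act -big_split /=.
have -> : #|T|%:R ^+ 2 * (p + eps) = \sum_(e : T * T) (p + eps).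
  by rewrite sumr_const card_prod mulnn -natrX mulr_natl.
apply: ler_sum => e _; rewrite /weight /= -mulrDr.
have c0 : 0 <= closing S e.1 e.2.
  by apply: sumr_ge0 => e' _; rewrite mulr_ge0 ?ler0n.
case Oe : (S.2 e.1 e.2) => /=.
  by rewrite mul1r lerD2l /kill_weight; have := mulr_ge0 p_ge0 c0; lra.
by rewrite mul0r addr_ge0.
Qed.

End Weights.

Lemma ler_sum_sub (R : realType) (I : finType) (Q : pred I) (f : I -> R) :
  (forall i, 0 <= f i) -> \sum_(i | Q i) f i <= \sum_i f i.
Proof.
by move=> f0; rewrite big_mkcond; apply: ler_sum => i _; case: (Q i).
Qed.

(** * Number of open pairs closed by a single action *)

Section Losses.
Variables (R : realType) (T : finType) (H : sgraph T) (S : state T).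
Hypothesis IS : valid H S.

(** A closed pair other than [e] consists of an end [a] of [e] and a neighbour of the opposite end
    [z]. Two orientations of [e] and two choices of the set containing [a] give [4 * c]. *)
Lemma lost_between e (A B : {set T}) (c : R) : S.2 e.1 e.2 -> 0 <= c ->
  (forall a z, same e a z -> a \in A ->
     \sum_(b in B) (S.1 z b)%:R * (S.2 a b)%:R <= c) ->
  (forall b z, same e b z -> b \in B ->
     \sum_(a in A) (S.1 z a)%:R * (S.2 b a)%:R <= c) ->
  \sum_(a in A) \sum_(b in B) (lost S (true, e) a b)%:R <= 2 + 4 * c.
Proof.
move=> Oe c0 hA hB.
have hl a b : (lost S (true, e) a b)%:R <= (same e a b)%:R
    + \sum_z (same e a z)%:R * ((S.1 z b)%:R * (S.2 a b)%:R)
    + \sum_z (same e b z)%:R * ((S.1 z a)%:R * (S.2 b a)%:R) :> R.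
  apply: le_trans (lost_add_le R IS _ _ Oe) _; rewrite !mulrDr.
  apply: lerD; first apply: lerD.
  - by rewrite ler_piMl ?ler0n ?ind_le1.
  - by rewrite big_distrr; apply: ler_sum => z _ /=; rewrite mulrC -mulrA.
  rewrite big_distrr; apply: ler_sum => z _ /=.
  by rewrite (valid_Osym IS b) (valid_Esym IS z) (sameC e b) mulrC mulrA
    (mulrC (same _ _ _)%:R).
have hc (X Y : {set T}) : (forall a z, same e a z -> a \in X ->
     \sum_(b in Y) (S.1 z b)%:R * (S.2 a b)%:R <= c) ->
  \sum_(a in X) \sum_(b in Y)
    \sum_z (same e a z)%:R * ((S.1 z b)%:R * (S.2 a b)%:R) <= 2 * c.
  move=> h; apply: (@le_trans _ _ (\sum_(a in X) \sum_z (same e a z)%:R * c)).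
    apply: ler_sum => a aX; rewrite exchange_big /=; apply: ler_sum => z _.
    rewrite -big_distrr /=; case se : (same e a z); last by rewrite !mul0r.
    by rewrite !mul1r h.
  under eq_bigr => a _ do rewrite -big_distrl /=.
  rewrite -big_distrl /= ler_wpM2r //.
  apply: le_trans (sum_same_all R e); apply: ler_sum_sub => a.
  by apply: sumr_ge0 => z _; exact: ler0n.
apply: le_trans (ler_sum _ (fun a _ => ler_sum _ (fun b _ => hl a b))) _.
under eq_bigr => a _ do rewrite !big_split /=.
rewrite !big_split /=.
have h1 : \sum_(a in A) \sum_(b in B) (same e a b)%:R <= 2 :> R.
  apply: le_trans (sum_same_all R e).
  apply: (@le_trans _ _ (\sum_a \sum_(b in B) (same e a b)%:R)).
    by apply: ler_sum_sub => a; apply: sumr_ge0 => z _; exact: ler0n.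
  by apply: ler_sum => a _; apply: ler_sum_sub => b; exact: ler0n.
have h2 := hc _ _ hA; have := hc _ _ hB; rewrite exchange_big /=; lra.
Qed.

Variables (y z : R).
Hypothesis codeg_y : forall u v, u != v -> codeg R S.1 S.2 u v <= y.
Hypothesis codeg_z : forall u v, u != v -> codeg R S.1 S.1 u v <= z.
Hypothesis y_ge0 : 0 <= y.
Hypothesis z_ge1 : 1 <= z.

Lemma between_codeg_le (A B : rel T) (Y : {set T}) u v :
  \sum_(b in Y) (A u b)%:R * (B v b)%:R <= codeg R A B u v.
Proof. by apply: ler_sum_sub => b; rewrite mulr_ge0 ?ler0n. Qed.

Lemma lost_between_y a (A B : {set T}) : S.2 a.2.1 a.2.2 ->
  \sum_(u in A) \sum_(v in B) (lost S a u v)%:R <= 2 + 4 * y.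
Proof.
case: a => [[] e] /= Oe.
  apply: lost_between => // u v se _; apply: le_trans (between_codeg_le _ _ _ _ _) _;
    by apply: codeg_y; rewrite eq_sym (same_neq IS Oe se).
apply: (@le_trans _ _ 2); last by rewrite lerDl mulr_ge0.
apply: le_trans (sum_same_all R e).
apply: (@le_trans _ _ (\sum_u \sum_(v in B) (lost S (false, e) u v)%:R)).
  by apply: ler_sum_sub => u; apply: sumr_ge0 => w _; exact: ler0n.
apply: ler_sum => u _; apply: (@le_trans _ _ (\sum_v (lost S (false, e) u v)%:R)).
  by apply: ler_sum_sub => w; exact: ler0n.
by apply: ler_sum => w _; rewrite lost_kill; apply: ind_imp => /andP[].
Qed.

Lemma lost_deg a u : S.2 a.2.1 a.2.2 -> \sum_w (lost S a u w)%:R <= 2 + 4 * y.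
Proof.
move=> Oa; have := lost_between_y [set u] [set: T] Oa.
by rewrite big_set1; under eq_bigl => w do rewrite inE.
Qed.

(** If the added edge joins [v] to [t], the lost [w] are common neighbours of [u] and [t], so [z]
    bounds them unless [t] is [u]; hence the exclusion of adding [uv] itself. *)
Lemma lost_nbrs a u v : S.2 a.2.1 a.2.2 -> u != v -> ~~ (a.1 && same a.2 u v) ->
  \sum_w (S.1 u w)%:R * (lost S a v w)%:R <= 2 + 4 * z.
Proof.
move=> Oa uv; case: a Oa => [[] e] /= Oe ne.
  have -> : \sum_w (S.1 u w)%:R * (lost S (true, e) v w)%:R =
      \sum_(a in [set v]) \sum_(b in [set w | S.1 u w]) (lost S (true, e) a b)%:R :> R.
    rewrite big_set1 [RHS]big_mkcond; apply: eq_bigr => w _; rewrite inE.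
    by case: (S.1 u w); rewrite ?mul1r ?mul0r.
  apply: lost_between => //; first by have := z_ge1; lra.
    move=> a t se; rewrite inE => /eqP av; rewrite {a}av in se *.
    have tu : u != t by apply: contraNneq ne => ->; rewrite sameC.
    apply: le_trans (codeg_z tu); rewrite big_mkcond; apply: ler_sum => w _.
    rewrite inE; case: (S.1 u w); rewrite ?mul0r // mul1r.
    by rewrite ler_piMr ?ler0n ?ind_le1.
  move=> b t se _; rewrite big_set1 -ind_and; apply: le_trans z_ge1; exact: ind_le1.
apply: (@le_trans _ _ 2); last by rewrite lerDl mulr_ge0 // (le_trans ler01).
apply: le_trans (sum_same_r2 R e v); apply: ler_sum => w _.
rewrite lost_kill -ind_and; apply: ind_imp => /andP[_ /andP[]] //.
Qed.

(** An edge other than [uw] and [vw] closes both pairs only by joining [w] to a common chosen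
    neighbour of [u] and [v]. These are few, so simultaneous closures hardly affect the open
    codegree. *)
Lemma both_lost e u v w : S.2 e.1 e.2 -> u != v -> S.2 u w -> S.2 v w ->
  (lost S (true, e) u w && lost S (true, e) v w)%:R <=
  1 * (same e u w)%:R + 1 * (same e v w)%:R
  + \sum_t ((S.1 u t)%:R * (S.1 v t)%:R) * (same e t w)%:R :> R.
Proof.
move=> Oe uv Ouw Ovw; rewrite !mul1r.
have s0 : 0 <= \sum_t (S.1 u t)%:R * (S.1 v t)%:R * (same e t w)%:R :> R.
  by apply: sumr_ge0 => t _; rewrite !mulr_ge0 ?ler0n.
have [/andP[lu lv]|_] := boolP (lost _ _ _ _ && _); last first.
  by rewrite !addr_ge0 ?ler0n.
have [su|nu] := boolP (same e u w).
  by have := ler0n R (same e v w); rewrite /= in s0 *; lra.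
have [sv|nv] := boolP (same e v w); first by rewrite /= in s0 *; lra.
rewrite /= !add0r.
have uw : u != w by apply: contraTneq Ouw => ->; rewrite (valid_Oirr IS).
have vw : v != w by apply: contraTneq Ovw => ->; rewrite (valid_Oirr IS).
case: (lost_addP IS Oe lu) => [|[t h1 h2]|[t h1 h2]]; first by rewrite (negbTE nu).
  case: (lost_addP IS Oe lv) => [|[t' h1' h2']|[t' h1' h2']]; first by rewrite (negbTE nv).
    exfalso; have tv : t = v.
      move: h1 h1'; rewrite /same => /orP[]/andP[/eqP a /eqP b] /orP[]/andP[/eqP c /eqP d];
      move/eqP: uv; congruence.
    by apply: (valid_disj IS Ovw); rewrite -tv.
  exfalso; have : t = w \/ u = w.
    move: h1 h2'; rewrite /same => /orP[]/andP[/eqP a /eqP b] /orP[]/andP[/eqP c /eqP d];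
    first [by left; congruence | by right; congruence].
  by case=> h; [move: h2; rewrite h (valid_Eirr IS)|move: uw; rewrite h eqxx].
case: (lost_addP IS Oe lv) => [|[t' h1' h2']|[t' h1' h2']]; first by rewrite (negbTE nv).
  exfalso; have : t' = w \/ v = w.
    move: h2 h1'; rewrite /same => /orP[]/andP[/eqP a /eqP b] /orP[]/andP[/eqP c /eqP d];
    first [by left; congruence | by right; congruence].
  by case=> h; [move: h2'; rewrite h (valid_Eirr IS)|move: vw; rewrite h eqxx].
have tt : t = t'.
  move: (same_neq IS Oe h2) (same_neq IS Oe h2').
  move: h2 h2'; rewrite /same.
  by move=> /orP[]/andP[/eqP a /eqP b] /orP[]/andP[/eqP c /eqP d] /eqP ? /eqP ?;
    congruence.
rewrite (bigD1 t) //= h1 tt h1' -tt h2 !mulr1 lerDl.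
by apply: sumr_ge0 => ? _; rewrite !mulr_ge0 ?ler0n.
Qed.

Lemma both_lost_kill e u v w : S.2 e.1 e.2 -> u != v ->
  lost S (false, e) u w && lost S (false, e) v w = false.
Proof.
move=> Oe uv; rewrite !lost_kill; apply/negP => /andP[/andP[_ h1] /andP[_ h2]].
move: (same_neq IS Oe h1) (same_neq IS Oe h2).
move: h1 h2 uv; rewrite /same => /orP[]/andP[/eqP a /eqP b].
  by move=> /orP[]/andP[/eqP c /eqP d] /eqP ? /eqP ? /eqP ?; congruence.
by move=> /orP[]/andP[/eqP c /eqP d] /eqP ? /eqP ? /eqP ?; congruence.
Qed.

End Losses.

(** * Vertices with many chosen neighbours in a set *)

Section Heavy.
Variables (R : realType) (T : finType) (E : rel T).

Definition deg (B : {set T}) v : R := \sum_(b in B) (E v b)%:R.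

Definition heavy (B : {set T}) (h : R) : R := \sum_v (h < deg B v)%R%:R.

Lemma heavy_ge0 B h : 0 <= heavy B h.
Proof. by apply: sumr_ge0 => b _; exact: ler0n. Qed.

(* Cauchy-Schwarz: small codegrees make the edges from heavy vertices to [B]
   almost disjoint. *)
Lemma heavy_le (B : {set T}) (h z : R) :
  (forall u v, u != v -> codeg R E E u v <= z) -> 0 <= z ->
  0 < h -> 2 * #|B|%:R * z <= h ^+ 2 -> heavy B h * h <= 2 * #|B|%:R.
Proof.
move=> codeg_z z0 h0 hz; set s : R := #|B|%:R.
have s0 : 0 <= s by exact: ler0n.
pose D v : R := (h < deg B v)%R%:R.
have D0 v : 0 <= D v by exact: ler0n.
have DD v : D v * D v = D v by rewrite /D; case: (_ < _); rewrite ?mulr1 ?mulr0.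
pose d b : R := \sum_v D v * (E v b)%:R.
pose M := heavy B h; pose X := \sum_(b in B) d b.
have M0 : 0 <= M by exact: heavy_ge0.
have X0 : 0 <= X by apply: sumr_ge0 => b _; apply: sumr_ge0 => v _; rewrite mulr_ge0 ?ler0n.
have XE : X = \sum_v D v * deg B v.
  by rewrite /X /d exchange_big; apply: eq_bigr => v _; rewrite big_distrr.
have MX : M * h <= X.
  rewrite XE /M /heavy big_distrl; apply: ler_sum => v _ /=; rewrite /D.
  by case: ltrP => [/ltW hv|_]; rewrite ?mul1r ?mul0r.
(* Second moment of the number [d b] of heavy neighbours: the diagonal gives at most [X], every
   other pair of heavy vertices at most the codegree bound [z]. *)
have d2 : \sum_(b in B) d b ^+ 2 <= X + M ^+ 2 * z.
  have -> : \sum_(b in B) d b ^+ 2 =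
      \sum_u \sum_v D u * D v * \sum_(b in B) (E u b)%:R * (E v b)%:R.
    rewrite (eq_bigr (fun b => \sum_u \sum_v D u * D v * ((E u b)%:R * (E v b)%:R))).
      rewrite exchange_big; apply: eq_bigr => u _ /=.
      by rewrite exchange_big; apply: eq_bigr => v _ /=; rewrite big_distrr.
    move=> b _; rewrite expr2 {1}/d big_distrl; apply: eq_bigr => u _ /=.
    by rewrite /d big_distrr; apply: eq_bigr => v _ /=; ring.
  have -> : X + M ^+ 2 * z = \sum_u \sum_v ((v == u)%:R * (D u * deg B u) + D u * D v * z).
    rewrite (eq_bigr (fun u => D u * deg B u + D u * (M * z))); last first.
      move=> u _; rewrite big_split /= (sum_ind_eq u (fun=> D u * deg B u)).
      by rewrite -big_distrl -big_distrr /= mulrA.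
    by rewrite big_split -XE -big_distrl /=; rewrite /M /heavy expr2 mulrA.
  apply: ler_sum => u _; apply: ler_sum => v _.
  have [->|vu] := eqVneq v u.
    rewrite mul1r DD; apply: (@le_trans _ _ (D u * deg B u)); last first.
      by rewrite lerDl mulr_ge0.
    rewrite ler_wpM2l //; apply: ler_sum => b _.
    by rewrite ler_piMr ?ler0n ?ind_le1.
  rewrite mul0r add0r ler_wpM2l ?mulr_ge0 //.
  rewrite eq_sym in vu; apply: le_trans (codeg_z _ _ vu).
  exact: between_codeg_le.
have CS : s * X ^+ 2 <= s * (s * \sum_(b in B) d b ^+ 2).
  have : 0 <= \sum_(b in B) (s * d b - X) ^+ 2.
    by apply: sumr_ge0 => b _; exact: sqr_ge0.
  have -> : \sum_(b in B) (s * d b - X) ^+ 2 =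
      s ^+ 2 * (\sum_(b in B) d b ^+ 2) - 2 * s * X * X + s * X ^+ 2.
    rewrite (eq_bigr (fun b => s ^+ 2 * d b ^+ 2 - 2 * s * X * d b + X ^+ 2)).
      by rewrite big_split sumrB /= sumr_const -!big_distrr /= -[_ *+ #|B|]mulr_natl.
    by move=> b _; ring.
  set Y := \sum_(b in B) _; lra.
have [s00|s1] := eqVneq s 0.
  apply: le_trans MX _; rewrite s00 mulr0 XE big1 // => v _.
  have B0 : B = set0 by apply/eqP; rewrite -cards_eq0 -(pnatr_eq0 R) -/s s00.
  by rewrite /deg B0 big_set0 mulr0.
have sp : 0 < s by rewrite lt_def s1.
have {CS} CS : X ^+ 2 <= s * \sum_(b in B) d b ^+ 2 by rewrite -(ler_pM2l sp).
have h1 := ler_wpM2l s0 d2.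
(* The assumption on [h] makes the off-diagonal part, times [s], at most half of [X ^+ 2], which
   leaves [X <= 2 * s]. *)
have h2 : M ^+ 2 * (2 * s * z) <= X ^+ 2.
  apply: (@le_trans _ _ (M ^+ 2 * h ^+ 2)); first by rewrite ler_wpM2l ?sqr_ge0.
  by rewrite -exprMn ler_sqr ?nnegrE // mulr_ge0 // ltW.
apply: le_trans MX _.
have h3 : X * X <= 2 * s * X by move: h1 CS h2; set Y := \sum_(b in B) _; lra.
have [->|Xn] := eqVneq X 0; first by rewrite mulr_ge0.
by rewrite -(ler_pM2r (_ : 0 < X)) // lt_def Xn.
Qed.

End Heavy.

(** The requirement [controlled] of the derandomisation for one quantity. Since [y] only bounds the
    increment from above, downward jumps may be left out of the quadratic term. *)
Definition step_control (R : realType) (I : finType) (P Vnext : I -> R)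
    (Vstay Vnow lam drift om : R) : Prop :=
  exists y : I -> R,
  [/\ forall a, 0 < P a -> Vnext a - Vstay <= y a,
      \sum_a P a * y a + (Vstay - Vnow) <= drift &
      \sum_a P a * ((lam * y a) ^+ 2 * expR `|lam * y a|) <= om].

(** * One-step control of each tracked quantity *)

Section Control.
Variables (R : realType) (T : finType) (H : sgraph T) (p eps q y z : R).
Variable S : state T.
Hypothesis IS : valid H S.
Hypothesis p_ge0 : 0 <= p.
Hypothesis codeg_y : forall u v, u != v -> codeg R S.1 S.2 u v <= y.
Hypothesis codeg_z : forall u v, u != v -> codeg R S.1 S.1 u v <= z.
Hypothesis y_ge0 : 0 <= y.
Hypothesis z_ge1 : 1 <= z.
Hypothesis p_eps : p * (2 + 4 * y) <= eps.
Hypothesis q_gt0 : 0 < q.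
Hypothesis eps_ge0 : 0 <= eps.
Hypothesis eps_le : eps <= 2^-1.

Let W := weight p eps S.
Let q' := q * (1 - eps).

Let W_ge0 a : 0 <= W a.
Proof. exact: (weight_ge0 IS p_ge0 codeg_y p_eps a). Qed.

Let e1_gt0 : 0 < 1 - eps.
Proof. by rewrite subr_gt0 (le_lt_trans eps_le) // invf_lt1 ?ltr1n. Qed.

Let q'_gt0 : 0 < q'.
Proof. by rewrite mulr_gt0. Qed.

Lemma perform_Oind a u v :
  ((perform S a).2 u v)%:R = (S.2 u v)%:R - (lost S a u v)%:R :> R.
Proof.
rewrite perform_O /lost; case: (S.2 u v); case: (_ a).2 => /=; by rewrite ?subr0 ?subrr.
Qed.

Lemma sum_weight_both u v w : u != v -> S.2 u w -> S.2 v w ->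
  \sum_a W a * (lost S a u w && lost S a v w)%:R <= p * (4 + 2 * z).
Proof.
move=> uv Ouw Ovw; rewrite sum_act [X in _ + X]big1 ?addr0; last first.
  move=> e _; rewrite /W /weight /=; case Oe : (S.2 e.1 e.2); last by rewrite !mul0r.
  by rewrite (both_lost_kill IS _ Oe uv) mulr0.
apply: (@le_trans _ _ (p * \sum_e (S.2 e.1 e.2)%:R *
  (1 * (same e u w)%:R + 1 * (same e v w)%:R
  + \sum_t ((S.1 u t)%:R * (S.1 v t)%:R) * (same e t w)%:R))).
  rewrite big_distrr; apply: ler_sum => e _; rewrite /W /weight /=.
  case Oe : (S.2 e.1 e.2); last by rewrite !mul0r mulr0.
  rewrite !mul1r ler_wpM2l //; have := both_lost R IS Oe uv Ouw Ovw; by rewrite !mul1r.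
apply: ler_wpM2l => //.
under eq_bigr => e _ do rewrite !mulrDr big_distrr /=.
rewrite !big_split /= !(sum_weight_ind IS) exchange_big /=.
under [X in _ + X]eq_bigr => t _ do rewrite (sum_weight_ind IS).
have h : \sum_t 2 * ((S.1 u t)%:R * (S.1 v t)%:R) * (S.2 t w)%:R <= 2 * z.
  apply: le_trans (ler_wpM2l _ (codeg_z uv)) => //.
  rewrite big_distrr; apply: ler_sum => t _ /=.
  by rewrite ler_piMr ?ind_le1 // !mulr_ge0 ?ler0n.
by rewrite Ouw Ovw /= !mulr1; move: h; set s := \sum_i _; lra.
Qed.

(** Both pairs at a common open neighbour close with weight [eps], and passing from [q ^+ 2] to
    [q' ^+ 2] offsets this. Upward drift comes only from simultaneous closures, bounded by
    [sum_weight_both]. *)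
Lemma control_open_codeg u v (x lam drift th om : R) : u != v ->
  0 <= lam -> th <= 1 -> codeg R S.2 S.2 u v <= x ->
  p * (4 + 2 * z) * x / q' ^+ 2 <= drift ->
  lam * ((4 + 8 * y) / q' ^+ 2) <= th ->
  4 * th * (lam * (2 * eps * x / q' ^+ 2)) <= om ->
  step_control W (fun a => codeg R (perform S a).2 (perform S a).2 u v / q' ^+ 2)
    (codeg R S.2 S.2 u v / q' ^+ 2) (codeg R S.2 S.2 u v / q ^+ 2) lam drift om.
Proof.
move=> uv l0 t1 hx hd hth hom.
have th0 : 0 <= th.
  by apply: le_trans hth; rewrite mulr_ge0 // divr_ge0 ?sqr_ge0 // addr_ge0 // mulr_ge0.
pose phi w : R := (S.2 u w)%:R * (S.2 v w)%:R.
pose J a : R := \sum_w phi w * (lost S a u w || lost S a v w)%:R.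
have phi0 w : 0 <= phi w by rewrite mulr_ge0 ?ler0n.
have phi1 w : phi w <= 1 by rewrite /phi -ind_and ind_le1.
have J0 a : 0 <= J a by apply: sumr_ge0 => w _; rewrite mulr_ge0 ?ler0n.
have Q0 : 0 < q' ^+ 2 by rewrite exprn_gt0.
have JE a : J a = \sum_w phi w * (lost S a u w)%:R + \sum_w phi w * (lost S a v w)%:R
    - \sum_w phi w * (lost S a u w && lost S a v w)%:R.
  rewrite -big_split -sumrB; apply: eq_bigr => w _ /=.
  by case: (lost S a u w); case: (lost S a v w) => /=; ring.
have Jle a : W a * J a <=
    W a * (\sum_w phi w * (lost S a u w)%:R + \sum_w phi w * (lost S a v w)%:R).
  apply: ler_wpM2l => //; rewrite JE gerBl.
  by apply: sumr_ge0 => w _; rewrite mulr_ge0 ?ler0n.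
have phiO1 w : phi w * (S.2 u w)%:R = phi w.
  by rewrite /phi; case: (S.2 u w); rewrite ?mulr1 ?mul0r.
have phiO2 w : phi w * (S.2 v w)%:R = phi w.
  by rewrite /phi; case: (S.2 v w); rewrite ?mulr1 ?mulr0 ?mul0r.
have sumL : \sum_a
    W a * (\sum_w phi w * (lost S a u w)%:R + \sum_w phi w * (lost S a v w)%:R)
    = 2 * eps * codeg R S.2 S.2 u v.
  under eq_bigr => a _ do rewrite mulrDr.
  rewrite big_split /= (sum_weight_lost_sum p eps IS xpredT phi (fun=> u) id).
  rewrite (sum_weight_lost_sum p eps IS xpredT phi (fun=> v) id) /=.
  under eq_bigr => w _ do rewrite phiO1.
  under [X in _ + _ * X]eq_bigr => w _ do rewrite phiO2.
  by rewrite /codeg -/phi; ring.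
have sumJ_le : \sum_a W a * J a <= 2 * eps * codeg R S.2 S.2 u v.
  by rewrite -sumL; apply: ler_sum.
have sumJ_ge : (2 * eps - p * (4 + 2 * z)) * codeg R S.2 S.2 u v <= \sum_a W a * J a.
  rewrite mulrBl -sumL.
  under [X in _ <= X]eq_bigr => a _ do rewrite JE mulrBr.
  rewrite sumrB lerD2l lerN2.
  under eq_bigr => a _ do rewrite big_distrr /=.
  rewrite exchange_big big_distrr /=; apply: ler_sum => w _.
  under eq_bigr => a _ do rewrite mulrCA.
  rewrite -big_distrr /= /phi.
  case Ouw : (S.2 u w); last by rewrite !mul0r mulr0.
  case Ovw : (S.2 v w); last by rewrite mulr0 !mul0r mulr0.
  by rewrite !mul1r mulr1 sum_weight_both.
exists (fun a => - (J a / q' ^+ 2)); split.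
- move=> a _; rewrite -mulrBl -mulNr ler_pM2r ?invr_gt0 // /codeg -sumrB -sumrN.
  apply: ler_sum => w _; rewrite !perform_Oind /phi.
  rewrite /lost; case: (S.2 u w); case: (S.2 v w); case: ((perform S a).2 u w);
    case: ((perform S a).2 v w) => /=; lra.
- under eq_bigr => a _ do rewrite mulrN mulrA.
  rewrite sumrN -big_distrl /=.
  apply: le_trans hd.
  have -> : codeg R S.2 S.2 u v / q ^+ 2 = codeg R S.2 S.2 u v * (1 - eps) ^+ 2 / q' ^+ 2.
    by rewrite /q'; field; rewrite !gt_eqF.
  rewrite -mulrBl -mulNr -mulrDl ler_pM2r ?invr_gt0 //.
  have := codeg_ge0 R S.2 S.2 u v; set X := codeg R _ _ _ _ in hx sumJ_ge sumJ_le *.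
  move=> X0; have pz : 0 <= p * (4 + 2 * z).
    by rewrite mulr_ge0 // addr_ge0 // mulr_ge0 // (le_trans ler01).
  have := ler_wpM2l pz hx; have := mulr_ge0 X0 (sqr_ge0 eps); lra.
apply: le_trans hom.
apply: le_trans (quadratic_le (g := fun a => J a / q' ^+ 2) W_ge0 l0 t1 _ _) _.
- by move=> a _; rewrite normrN ger0_norm // divr_ge0 // ltW.
- move=> a Wa; apply: le_trans hth; rewrite ler_wpM2l // ler_pM2r ?invr_gt0 //.
  have Oa := weight_gt0_O Wa.
  apply: (@le_trans _ _ (\sum_w (lost S a u w)%:R + \sum_w (lost S a v w)%:R)).
    rewrite -big_split; apply: ler_sum => w _ /=.
    apply: le_trans (ind_or_le _ _ _); by rewrite ler_piMl ?ler0n.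
  have := lost_deg IS codeg_y y_ge0 u Oa; have := lost_deg IS codeg_y y_ge0 v Oa; lra.
apply: ler_wpM2l; first by rewrite mulr_ge0.
apply: ler_wpM2l => //; under eq_bigr => a _ do rewrite mulrA.
rewrite -big_distrl /= ler_pM2r ?invr_gt0 //; apply: le_trans sumJ_le _.
by rewrite ler_wpM2l // mulr_ge0.
Qed.

Lemma performed_E a u v : (perform S a).1 u v = S.1 u v || (a.1 && same a.2 u v).
Proof. by case: a => [[] e] /=; rewrite ?orbF. Qed.

Lemma sum_weight_same (f : T -> R) u :
  \sum_a W a * (if a.1 then \sum_w f w * (same a.2 u w)%:R else 0)
  = 2 * p * \sum_w f w * (S.2 u w)%:R.
Proof.
rewrite (sum_weight_add p eps S (fun e => \sum_w f w * (same e u w)%:R)).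
under eq_bigr => e _ do rewrite big_distrr /=.
rewrite exchange_big /= -mulrA mulrCA; congr (_ * _); rewrite big_distrr.
by apply: eq_bigr => w _ /=; rewrite (sum_weight_ind IS) mulrA.
Qed.

Lemma sum_same_weighted_le e u (f : T -> R) : (forall w, f w <= 1) ->
  \sum_w f w * (same e u w)%:R <= 2.
Proof.
move=> f1; apply: le_trans (sum_same_r2 R e u); apply: ler_sum => w _.
by rewrite ler_piMl ?ler0n.
Qed.

(* Adding the edge [uv] itself may destroy all common neighbours counted by
   [codeg S.1 S.2 u v] at once; this jump is downward, so that it is discarded
   instead of entering the quadratic term. *)
Lemma control_mixed_codeg u v (x lam drift th om : R) : u != v ->
  0 <= lam -> th <= 1 -> codeg R S.2 S.2 u v <= x ->
  (2 * p * x + 2 * p * y) / q' <= drift ->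
  lam * ((4 + 4 * z) / q') <= th ->
  4 * th * (lam * ((2 * p * x + eps * y) / q')) <= om ->
  step_control W (fun a => codeg R (perform S a).1 (perform S a).2 u v / q')
    (codeg R S.1 S.2 u v / q') (codeg R S.1 S.2 u v / q) lam drift om.
Proof.
move=> uv l0 t1 hx hd hth hom.
have z0 : 0 <= z by apply: le_trans z_ge1.
have th0 : 0 <= th.
  by apply: le_trans hth; rewrite mulr_ge0 // divr_ge0 ?(ltW q'_gt0) // addr_ge0 // mulr_ge0.
pose gain (a : act T) : R :=
  if a.1 then \sum_w (S.2 v w)%:R * (same a.2 u w)%:R else 0.
pose loss0 a : R := \sum_w (S.1 u w)%:R * (lost S a v w)%:R.
pose loss a : R := if a.1 && same a.2 u v then 0 else loss0 a.
have gain0 a : 0 <= gain a.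
  rewrite /gain; case: a.1 => //; apply: sumr_ge0 => w _; by rewrite mulr_ge0 ?ler0n.
have loss00 a : 0 <= loss0 a.
  by apply: sumr_ge0 => w _; rewrite mulr_ge0 ?ler0n.
have loss_ge0 a : 0 <= loss a by rewrite /loss; case: ifP.
have Y0 := codeg_ge0 R S.1 S.2 u v; have hY := codeg_y uv.
have loss0_le a : loss0 a <= codeg R S.1 S.2 u v.
  apply: ler_sum => w _; rewrite ler_wpM2l ?ler0n //.
  by apply: ind_imp => /andP[].
have sum_gain : \sum_a W a * gain a = 2 * p * codeg R S.2 S.2 u v.
  rewrite (sum_weight_same (fun w => (S.2 v w)%:R)); congr (_ * _).
  by apply: eq_bigr => w _; rewrite mulrC.
have sum_loss0 : \sum_a W a * loss0 a = eps * codeg R S.1 S.2 u v.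
  exact: (sum_weight_lost_sum p eps IS xpredT (fun w => (S.1 u w)%:R) (fun=> v) id).
have sum_loss_le : \sum_a W a * loss a <= eps * codeg R S.1 S.2 u v.
  rewrite -sum_loss0; apply: ler_sum => a _; rewrite ler_wpM2l // /loss.
  by case: ifP.
(* Ignoring the loss when [uv] itself is added changes the mean by at most the weight [2 * p] of
   that action times the codegree; this is the term [2 * p * y] of the drift. *)
have sum_loss_ge : (eps - 2 * p) * codeg R S.1 S.2 u v <= \sum_a W a * loss a.
  have : \sum_a W a * loss0 a - \sum_a W a * loss a <= 2 * p * codeg R S.1 S.2 u v.
    rewrite -sumrB.
    apply: (@le_trans _ _ (\sum_a W a *
      (if a.1 then codeg R S.1 S.2 u v * (same a.2 u v)%:R else 0))).
      apply: ler_sum => a _; rewrite -mulrBr ler_wpM2l // /loss.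
      case: a.1 => /=; last by rewrite subrr.
      by case: (same a.2 u v) => /=; rewrite ?subr0 ?mulr1 ?subrr ?mulr0.
    rewrite (sum_weight_add p eps S (fun e => codeg R S.1 S.2 u v * (same e u v)%:R)).
    rewrite (sum_weight_ind IS).
    have -> : p * (2 * codeg R S.1 S.2 u v * (S.2 u v)%:R) =
      2 * p * codeg R S.1 S.2 u v * (S.2 u v)%:R by ring.
    by rewrite ler_piMr ?ind_le1 // !mulr_ge0.
  rewrite sum_loss0; lra.
exists (fun a => (gain a - loss a) / q'); split.
- move=> a Wa; rewrite -mulrBl ler_pM2r ?invr_gt0 //.
  apply: (@le_trans _ _ (gain a - loss0 a)); last first.
    rewrite lerD2l lerN2 /loss; by case: ifP.
  rewrite /gain /loss0 /codeg.
  have -> : (if a.1 then \sum_w (S.2 v w)%:R * (same a.2 u w)%:R else 0) =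
      \sum_w (S.2 v w)%:R * (a.1 && same a.2 u w)%:R :> R.
    by case: a.1 => //=; rewrite big1 // => w _; rewrite mulr0.
  rewrite -!sumrB; apply: ler_sum => w _; rewrite performed_E perform_O /lost.
  case: (S.1 u w); case: (S.2 v w); case: (_ && _); case: (_.2 v w) => /=; lra.
- under eq_bigr => a _ do rewrite mulrA mulrBr.
  rewrite -big_distrl sumrB /= sum_gain.
  apply: le_trans hd.
  have -> : codeg R S.1 S.2 u v / q = codeg R S.1 S.2 u v * (1 - eps) / q'.
    by rewrite /q'; field; rewrite !gt_eqF.
  rewrite -mulrBl -mulrDl ler_pM2r ?invr_gt0 //.
  have h1 := ler_wpM2l p_ge0 hx; have h2 := ler_wpM2l p_ge0 hY.
  lra.
apply: le_trans hom.
apply: le_trans (quadratic_le (g := fun a => (gain a + loss a) / q') W_ge0 l0 t1 _ _) _.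
- move=> a _; rewrite normrM (ger0_norm (x := q'^-1)) ?invr_ge0 ?(ltW q'_gt0) //.
  rewrite ler_pM2r ?invr_gt0 //; apply: le_trans (ler_normB _ _) _.
  by rewrite !ger0_norm.
- move=> a Wa; apply: le_trans hth; rewrite ler_wpM2l // ler_pM2r ?invr_gt0 //.
  have Oa := weight_gt0_O Wa.
  have hg : gain a <= 2.
    rewrite /gain; case: a.1 => //; apply: sum_same_weighted_le => w; exact: ind_le1.
  have hl : loss a <= 2 + 4 * z.
    rewrite /loss; case: ifP => [_|/negbT ns]; first by rewrite addr_ge0 // mulr_ge0.
    exact: (lost_nbrs IS codeg_z z_ge1 Oa uv ns).
  lra.
apply: ler_wpM2l; first by rewrite mulr_ge0.
apply: ler_wpM2l => //; under eq_bigr => a _ do rewrite mulrA mulrDr.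
rewrite -big_distrl big_split /= ler_pM2r ?invr_gt0 // sum_gain.
have h1 := ler_wpM2l p_ge0 hx; have h2 := ler_wpM2l eps_ge0 hY; lra.
Qed.

(** A common neighbour arises only by choosing an open pair between one end and a neighbour of the
    other; the two mixed codegrees count these, with weight [2 * p] each. One edge gains at most 4,
    so [lam = 4^-1] keeps the scaled jump at most 1. *)
Lemma control_edge_codeg u v (om drift : R) : u != v ->
  4 * p * y <= drift -> 4 * p * y <= om ->
  step_control W (fun a => codeg R (perform S a).1 (perform S a).1 u v)
    (codeg R S.1 S.1 u v) (codeg R S.1 S.1 u v) 4^-1 drift om.
Proof.
move=> uv hd hom.
pose gain (a : act T) : R :=
  (if a.1 then \sum_w (S.1 v w)%:R * (same a.2 u w)%:R else 0) +
  (if a.1 then \sum_w (S.1 u w)%:R * (same a.2 v w)%:R else 0).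
have gain0 a : 0 <= gain a.
  rewrite /gain; case: a.1; rewrite addr_ge0 // sumr_ge0 // => w _;
  by rewrite mulr_ge0 ?ler0n.
have sum_gain : \sum_a W a * gain a <= 4 * p * y.
  rewrite /gain; under eq_bigr => a _ do rewrite mulrDr.
  rewrite big_split /= !sum_weight_same.
  have vu : v != u by rewrite eq_sym.
  have h1 := ler_wpM2l p_ge0 (codeg_y uv).
  have h2 := ler_wpM2l p_ge0 (codeg_y vu).
  rewrite /codeg in h1 h2; lra.
exists gain; split.
- move=> a Wa; rewrite /gain /codeg -sumrB.
  have hh (f : T -> R) t : (if a.1 then \sum_w f w * (same a.2 t w)%:R else 0) =
      \sum_w f w * (a.1 && same a.2 t w)%:R.
    by case: a.1 => //=; rewrite big1 // => w _; rewrite mulr0.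
  rewrite !hh -big_split; apply: ler_sum => w _; rewrite !performed_E.
  have : ~~ ((a.1 && same a.2 u w) && (a.1 && same a.2 v w)).
    apply/negP => /andP[/andP[_ h1] /andP[_ h2]].
    have Oa := weight_gt0_O Wa.
    move: (same_neq IS Oa h1) (same_neq IS Oa h2) uv.
    move: h1 h2; rewrite /same => /orP[]/andP[/eqP a1 /eqP b1].
      by move=> /orP[]/andP[/eqP c1 /eqP d1] /eqP ? /eqP ? /eqP ?; congruence.
    by move=> /orP[]/andP[/eqP c1 /eqP d1] /eqP ? /eqP ? /eqP ?; congruence.
  case: (S.1 u w); case: (S.1 v w); case: (_ && same _ u w);
    case: (_ && same _ v w) => //= _; lra.
- by rewrite subrr addr0; exact: le_trans sum_gain hd.
apply: le_trans hom.
apply: le_trans (quadratic_le (g := gain) (th := 1) W_ge0 _ _ _ _) _ => //.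
- by rewrite invr_ge0.
- by move=> a _; rewrite ger0_norm.
- move=> a _; have : gain a <= 4; last by lra.
  rewrite /gain; case: a.1; last by rewrite addr0.
  have h1 := @sum_same_weighted_le a.2 u (fun w => (S.1 v w)%:R) (fun w => ind_le1 R _).
  have h2 := @sum_same_weighted_le a.2 v (fun w => (S.1 u w)%:R) (fun w => ind_le1 R _).
  lra.
by move: sum_gain; set X := \sum_a _; lra.
Qed.

(** Only the addition of such a pair can close more than [2 + 4 * h] pairs between [A] and [B]. *)
Definition busy e (A B : {set T}) (h : R) :=
  [exists a, exists v, same e a v &&
    ((a \in A) && (h < deg R S.1 B v) || (a \in B) && (h < deg R S.1 A v))].

Lemma sum_busy_le (A B : {set T}) h :
  \sum_e (busy e A B h)%:R <=
  2 * (#|A|%:R * heavy S.1 B h + #|B|%:R * heavy S.1 A h) :> R.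
Proof.
pose c a v : R :=
  (a \in A)%:R * (h < deg R S.1 B v)%R%:R + (a \in B)%:R * (h < deg R S.1 A v)%R%:R.
have hb e : (busy e A B h)%:R <= \sum_a \sum_v (same e a v)%:R * c a v.
  apply: le_trans (ind_exists_le _ _) _; apply: ler_sum => a _.
  apply: le_trans (ind_exists_le _ _) _; apply: ler_sum => v _.
  rewrite ind_and ler_wpM2l ?ler0n // /c -!ind_and; exact: ind_or_le.
apply: le_trans (ler_sum _ (fun e _ => hb e)) _.
rewrite exchange_big /=; under eq_bigr => a _ do rewrite exchange_big /=.
apply: (@le_trans _ _ (\sum_a \sum_v 2 * c a v)).
  apply: ler_sum => a _; apply: ler_sum => v _; rewrite -big_distrl /=.
  apply: ler_wpM2r; last exact: sum_same_e.
  by rewrite addr_ge0 // mulr_ge0 ?ler0n.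
under eq_bigr => a _ do rewrite -big_distrr /= big_split -!big_distrr /=.
rewrite -big_distrr /= big_split -!big_distrl /= !sum_ind_mem.
by rewrite lexx.
Qed.

Lemma sum_weight_lost_between (A B : {set T}) :
  \sum_a W a * \sum_(u in A) \sum_(v in B) (lost S a u v)%:R =
  eps * between R S.2 A B.
Proof.
under eq_bigr => a _ do rewrite big_distrr /=.
rewrite exchange_big big_distrr; apply: eq_bigr => u _ /=.
under eq_bigr => a _ do rewrite big_distrr /=.
rewrite exchange_big big_distrr; apply: eq_bigr => v _ /=.
by rewrite (sum_weight_lost p eps IS).
Qed.

(* Large jumps come from the few vertices with many neighbours in [A] or [B];
   for those only the crude bound [w ^+ 3] on the exponential is needed. *)
Lemma control_open_between (A B : {set T}) (sg lam th om h w fm : R) :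
  `|sg| = 1 -> 0 <= lam -> th <= 1 -> 0 <= h ->
  between R S.2 A B <= fm ->
  lam * ((2 + 4 * h) / q') <= th ->
  expR (lam * ((2 + 4 * y) / q')) <= w ->
  4 * th * (lam * (eps * fm / q'))
    + p * w ^+ 3 * (2 * (#|A|%:R * heavy S.1 B h + #|B|%:R * heavy S.1 A h)) <= om ->
  step_control W (fun a => sg * (between R (perform S a).2 A B / q'))
    (sg * (between R S.2 A B / q')) (sg * (between R S.2 A B / q)) lam 0 om.
Proof.
move=> sg1 l0 t1 h0 hf hth hw hom.
pose J a : R := \sum_(u in A) \sum_(v in B) (lost S a u v)%:R.
have J0 a : 0 <= J a by apply: sumr_ge0 => u _; apply: sumr_ge0 => v _; exact: ler0n.
have sumJ : \sum_a W a * J a = eps * between R S.2 A B := sum_weight_lost_between A B.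
have th0 : 0 <= th.
  by apply: le_trans hth; rewrite mulr_ge0 // divr_ge0 ?(ltW q'_gt0) // addr_ge0 // mulr_ge0.
have w0 : 0 <= w by apply: le_trans (expR_ge0 _) hw.
exists (fun a => - sg * (J a / q')); split.
- move=> a _; rewrite -mulrBr mulNr -mulrN -mulrBl -mulNr.
  suff -> : between R (perform S a).2 A B - between R S.2 A B = - J a by [].
  rewrite /between /J -sumrB -sumrN; apply: eq_bigr => u _.
  rewrite -sumrB -sumrN; apply: eq_bigr => v _; rewrite perform_Oind; ring.
(* Since every open pair is lost with weight exactly [eps] and [q' = q * (1 - eps)], the drift
   vanishes for both signs. *)
- rewrite (eq_bigr (fun a => W a * J a * (- sg / q'))); last by move=> a _; ring.
  rewrite -big_distrl /= sumJ le_eqVlt; apply/orP; left; apply/eqP.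
  by rewrite /q'; field; rewrite !gt_eqF.
apply: le_trans hom.
have yE a : `|lam * (- sg * (J a / q'))| = lam * (J a / q').
  rewrite !normrM normrN sg1 mul1r (ger0_norm l0) (ger0_norm (J0 a)).
  by rewrite (ger0_norm (x := q'^-1)) // invr_ge0 ltW.
(* Busy additions are charged [w ^+ 3], because the scaled jump [k] satisfies [k <= expR k <= w];
   every other action has [k <= th] and follows the usual quadratic bound. *)
have pt a : W a * ((lam * (- sg * (J a / q'))) ^+ 2 * expR `|lam * (- sg * (J a / q'))|) <=
   W a * (4 * th * (lam * (J a / q'))) +
   W a * (if a.1 then w ^+ 3 * (busy a.2 A B h)%:R else 0).
  have := W_ge0 a; rewrite le_eqVlt => /orP[/eqP<-|Wa]; first by rewrite !mul0r addr0.
  rewrite -mulrDr ler_pM2l // -[(_ * _) ^+ 2]real_normK ?num_real // yE.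
  set k := lam * (J a / q').
  have k0 : 0 <= k by rewrite mulr_ge0 // divr_ge0 // ltW.
  have e0 := expR_gt0 k.
  have Oa := weight_gt0_O Wa.
  have [/andP[a1 bs]|nb] := boolP (a.1 && busy a.2 A B h).
    rewrite a1 bs mulr1; apply: (@le_trans _ _ (w ^+ 3)); last first.
      by rewrite lerDr mulr_ge0 // mulr_ge0.
    have ew : expR k <= w.
      apply: le_trans hw; rewrite ler_expR ler_wpM2l // ler_pM2r ?invr_gt0 //.
      exact: (lost_between_y IS codeg_y y_ge0).
    have kw : k <= w by apply: le_trans ew; have := expR_ge1Dx k; lra.
    rewrite (exprSr w); apply: ler_pM => //; [exact: sqr_ge0|exact: ltW|].
    by rewrite ler_sqr ?nnegrE.
  apply: (@le_trans _ _ (4 * th * k)); last first.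
    by rewrite lerDl; case: a.1; rewrite // mulr_ge0 ?ler0n ?exprn_ge0.
  have kt : k <= th.
    apply: le_trans hth; rewrite ler_wpM2l // ler_pM2r ?invr_gt0 //.
    case: a nb Oa {Wa k k0 e0} => [[] e] /= nb Oe.
      have hs (X : {set T}) u v : deg R S.1 X v <= h ->
          \sum_(b in X) (S.1 v b)%:R * (S.2 u b)%:R <= h.
        by apply: le_trans; apply: ler_sum => b _; rewrite ler_piMr ?ler0n ?ind_le1.
      apply: (lost_between IS) => // u v se uX; apply: hs; rewrite leNgt;
        apply: contraNN nb => hv; apply/existsP; exists u; apply/existsP; exists v;
        by rewrite se uX hv ?orbT.
    apply: (@le_trans _ _ 2); last by rewrite lerDl mulr_ge0.
    apply: le_trans (sum_same_all R e).
    apply: (@le_trans _ _ (\sum_u \sum_(v in B) (lost S (false, e) u v)%:R)).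
      by apply: ler_sum_sub => u; apply: sumr_ge0 => t _; exact: ler0n.
    apply: ler_sum => u _; apply: (@le_trans _ _ (\sum_v (lost S (false, e) u v)%:R)).
      by apply: ler_sum_sub => t; exact: ler0n.
    by apply: ler_sum => t _; rewrite lost_kill; apply: ind_imp => /andP[].
  have e4 : expR k <= 4.
    by apply: le_trans (expR1_le4 R); rewrite ler_expR (le_trans kt).
  have -> : 4 * th * k = th * k * 4 by ring.
  apply: ler_pM; rewrite ?sqr_ge0 // ?(ltW e0) //.
  by rewrite expr2 ler_wpM2r.
apply: le_trans (ler_sum _ (fun a _ => pt a)) _; rewrite big_split; apply: lerD.
  rewrite (eq_bigr (fun a => W a * J a * (4 * th * lam / q'))); last by move=> a _; ring.
  rewrite -big_distrl /= sumJ.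
  have -> : 4 * th * (lam * (eps * fm / q')) = eps * fm * (4 * th * lam / q') by ring.
  apply: ler_wpM2r; last by rewrite ler_wpM2l.
  by rewrite divr_ge0 ?(ltW q'_gt0) // !mulr_ge0.
rewrite (sum_weight_add p eps S (fun e => w ^+ 3 * (busy e A B h)%:R)).
rewrite -mulrA ler_wpM2l //.
apply: (@le_trans _ _ (w ^+ 3 * \sum_e (busy e A B h)%:R)).
  rewrite big_distrr; apply: ler_sum => e _ /=.
  by rewrite ler_piMl ?ind_le1 // mulr_ge0 ?ler0n ?exprn_ge0.
by rewrite ler_wpM2l ?exprn_ge0 // sum_busy_le.
Qed.

(** The count grows at rate [2 * p] per open pair, one [p] for each orientation; [sg] treats upper
    and lower deviations together. *)
Lemma control_edge_between (A B : {set T}) (sg lam drift om fm : R) :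
  `|sg| = 1 -> 0 <= lam -> lam * 2 <= 1 -> between R S.2 A B <= fm ->
  sg * (2 * p * between R S.2 A B) <= drift ->
  4 * (lam * 2) * (lam * (2 * p * fm)) <= om ->
  step_control W (fun a => sg * between R (perform S a).1 A B)
    (sg * between R S.1 A B) (sg * between R S.1 A B) lam drift om.
Proof.
move=> sg1 l0 l2 hf hd hom.
pose D (a : act T) : R :=
  if a.1 then \sum_(u in A) \sum_(v in B) (same a.2 u v)%:R else 0.
have D0 a : 0 <= D a.
  rewrite /D; case: a.1 => //.
  by apply: sumr_ge0 => u _; apply: sumr_ge0 => v _; exact: ler0n.
have sumD : \sum_a W a * D a = 2 * p * between R S.2 A B.
  rewrite (sum_weight_add p eps S (fun e => \sum_(u in A) \sum_(v in B) (same e u v)%:R)).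
  under eq_bigr => e _ do rewrite big_distrr /=.
  rewrite exchange_big -mulrA mulrCA; congr (_ * _); rewrite big_distrr.
  apply: eq_bigr => u _ /=; under eq_bigr => e _ do rewrite big_distrr /=.
  rewrite exchange_big big_distrr; apply: eq_bigr => v _ /=.
  by rewrite (sum_same R IS).
exists (fun a => sg * D a); split.
- move=> a Wa; rewrite -mulrBr.
  suff -> : between R (perform S a).1 A B - between R S.1 A B = D a by [].
  have -> : D a = \sum_(u in A) \sum_(v in B) (a.1 && same a.2 u v)%:R.
    rewrite /D; case: a.1 => //=; rewrite big1 // => u _; exact: big1.
  rewrite /between -sumrB; apply: eq_bigr => u _.
  rewrite -sumrB; apply: eq_bigr => v _; rewrite performed_E.
  have : ~~ (S.1 u v && (a.1 && same a.2 u v)).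
    apply/negP => /andP[Euv /andP[_ se]].
    exact: (valid_disj IS (same_O IS (weight_gt0_O Wa) se) Euv).
  by case: (S.1 u v); case: (a.1 && same a.2 u v) => //= _; lra.
- rewrite subrr addr0; apply: le_trans hd.
  by under eq_bigr => a _ do rewrite mulrCA; rewrite -big_distrr /= sumD.
apply: le_trans hom.
apply: le_trans (quadratic_le (g := D) W_ge0 l0 l2 _ _) _.
- by move=> a _; rewrite normrM sg1 mul1r ger0_norm.
- move=> a _; rewrite ler_wpM2l // /D; case: a.1 => //.
  apply: le_trans (sum_same_all R a.2).
  apply: (@le_trans _ _ (\sum_u \sum_(v in B) (same a.2 u v)%:R)).
    by apply: ler_sum_sub => u; apply: sumr_ge0 => t _; exact: ler0n.
  by apply: ler_sum => u _; apply: ler_sum_sub => t; exact: ler0n.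
rewrite sumD ler_wpM2l ?mulr_ge0 // ler_wpM2l // ler_wpM2l // mulr_ge0 //.
Qed.

End Control.

Lemma card_sets_le (T : finType) (s : nat) :
  (#|[set A : {set T} | #|A| == s]| <= #|T| ^ s)%N.
Proof.
rewrite card_draws; apply: (@leq_trans (#|T| ^_ s)).
  by rewrite -bin_ffact leq_pmulr // fact_gt0.
elim: s => [|s IH]; first by rewrite ffactn0 expn0.
by rewrite ffactnSr expnSr leq_mul // leq_subr.
Qed.

(** * The whole process *)

Section Assembly.
Variables (R : realType) (T : finType) (H : sgraph T).
Variables (m rho tau L w gamma delta : R) (N s : nat).

(* [rho] is reached in [N] steps of length [tau], [Q i] is the target proportion
   of open pairs, [p i] the weight of adding an ordered pair, and [eps] exceeds
   the bound [p i * (2 + 4 * (5 * m * Q i))] on the weight of closing a pair. *)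
Let n : R := #|T|%:R.
Let z : R := 17 * L.
Let eps : R := 11 * m * tau.
Let Q (i : nat) : R := (1 - eps) ^+ i.
Let p (i : nat) : R := tau / (2 * Q i).
(** The [th] bound the scaled jumps of the open codegrees, mixed codegrees and open pairs between
    sets, and the [c] are their second-order costs per unit of time. The degree threshold [h] is the
    value at which non-busy jumps reach [thF]. *)
Let thX : R := 1760 * L * m * w / n.
Let thY : R := 64 * L * w * (1 + z) / m.
Let thF : R := delta / (6000 * L).
Let h : R := thF * delta * gamma * s%:R / (192 * L * w).
Let cX : R := 640 * thX * L * (11 * m).
Let cY : R := 32 * thY * (L / m) * (4 * n + 110 * m ^+ 2).
Let cF : R := 2816 * thF * s%:R * L * m / delta + 4 * w ^+ 4 * s%:R ^+ 2 / h.

Hypothesis L_ge1 : 1 <= L.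
Hypothesis w_ge1 : 1 <= w.
Hypothesis w_le_m : w <= m.
Hypothesis tau_gt0 : 0 < tau.
Hypothesis gamma_gt0 : 0 < gamma.
Hypothesis delta_gt0 : 0 < delta.
Hypothesis delta_le1 : delta <= 1.
Hypothesis n_ge8 : 8 <= n.
Hypothesis s_gt0 : (0 < s)%N.
Hypothesis expL : expR L = n.
Hypothesis tauN : tau * N%:R = rho.
Hypothesis n_rho : n * rho = m.
Hypothesis eps_le : eps <= 2^-1.
Hypothesis QN : w^-1 <= Q N.
Hypothesis prob : n ^+ 2 * (tau * w + eps) <= 1.
Hypothesis rho_w : 32 * rho * w * (2 + z) <= 1.
Hypothesis m_rho : 50 * (m * rho) <= L.
Hypothesis thX_le1 : thX <= 1.
Hypothesis cX_le : cX * rho <= L.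
Hypothesis thY_le1 : thY <= 1.
Hypothesis cY_le : cY * rho <= L.
Hypothesis h_ge1 : 1 <= h.
Hypothesis h_sqr : 2 * s%:R * z <= h ^+ 2.
Hypothesis h_rho : 8 * rho * w ^+ 4 * s%:R <= L * h.
(** With [704 = 16 * 44]: [lam] is at most [16 * L / (delta * gamma * s)] for open pairs between
    dense sets, and one action changes their normalised number by at most [44 * m]. *)
Hypothesis jump : expR (704 * m * L / (delta * gamma * s%:R)) <= w.

Let L_gt0 : 0 < L. Proof. exact: lt_le_trans L_ge1. Qed.
Let w_gt0 : 0 < w. Proof. exact: lt_le_trans w_ge1. Qed.
Let m_gt0 : 0 < m. Proof. exact: lt_le_trans w_le_m. Qed.
Let n_gt0 : 0 < n. Proof. exact: lt_le_trans n_ge8. Qed.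
Let sR_gt0 : 0 < s%:R :> R. Proof. by rewrite ltr0n. Qed.
Let h_gt0 : 0 < h. Proof. exact: lt_le_trans h_ge1. Qed.
Let tau_ge0 : 0 <= tau. Proof. exact: ltW. Qed.
Let L_ge0 : 0 <= L. Proof. exact: ltW. Qed.
Let w_ge0 : 0 <= w. Proof. exact: ltW. Qed.
Let m_ge0 : 0 <= m. Proof. exact: ltW. Qed.
Let n_ge0 : 0 <= n. Proof. exact: ltW. Qed.
Let h_ge0 : 0 <= h. Proof. exact: ltW. Qed.
Let delta_ge0 : 0 <= delta. Proof. exact: ltW. Qed.
Let z_ge1 : 1 <= z. Proof. by rewrite /z; have := L_ge1; lra. Qed.
Let eps_gt0 : 0 < eps. Proof. by rewrite !mulr_gt0. Qed.
Let thX_ge0 : 0 <= thX. Proof. by rewrite divr_ge0 // !mulr_ge0. Qed.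
Let thY_ge0 : 0 <= thY.
Proof.
by rewrite divr_ge0 // !mulr_ge0 // addr_ge0 // (le_trans ler01).
Qed.
Let thF_gt0 : 0 < thF. Proof. by rewrite divr_gt0 // mulr_gt0. Qed.
Let thF_le1 : thF <= 1.
Proof.
by rewrite ler_pdivrMr ?mulr_gt0 // mul1r; have := L_ge1; have := delta_le1; lra.
Qed.
Let e1_gt0 : 0 < 1 - eps.
Proof. by rewrite subr_gt0 (le_lt_trans eps_le) // invf_lt1 ?ltr1n. Qed.
Let Q_gt0 i : 0 < Q i. Proof. by rewrite exprn_gt0. Qed.
Let QS i : Q i.+1 = Q i * (1 - eps). Proof. by rewrite /Q exprSr. Qed.
Let QV i : (i <= N)%N -> (Q i)^-1 <= w.
Proof.
move=> iN; rewrite -(invrK w) lef_pV2 ?posrE ?invr_gt0 //.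
apply: le_trans QN _; apply: ler_wiXn2l => //; first exact: ltW.
by rewrite gerBl ltW.
Qed.
Let QSV i : (Q i.+1)^-1 <= 2 * (Q i)^-1.
Proof.
rewrite QS invfM mulrC ler_pM2r ?invr_gt0 //.
rewrite -(invrK 2) lef_pV2 ?posrE ?invr_gt0 //; have := eps_le; lra.
Qed.
Let p_gt0 i : 0 < p i. Proof. by rewrite divr_gt0 // mulr_gt0. Qed.
Let pQ i : 2 * p i * Q i = tau.
Proof. by rewrite /p; field; rewrite gt_eqF. Qed.
Let p_le i : (i <= N)%N -> p i <= tau * w / 2.
Proof.
move=> iN; have -> : p i = tau * (Q i)^-1 / 2 by rewrite /p; field; rewrite gt_eqF.
by rewrite ler_pM2r ?invr_gt0 // ler_pM2l // QV.
Qed.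
Let tau_i c i : 0 <= c -> (i <= N)%N -> c * tau * i%:R <= c * rho.
Proof.
by move=> c0 iN; rewrite -tauN -mulrA ler_wpM2l // ler_pM2l // ler_nat.
Qed.

Definition dense (A B : {set T}) :=
  [&& #|A| == s, #|B| == s & gamma * s%:R ^+ 2 <= between R (adj H) A B].

(** Three codegrees per pair of vertices (open, mixed, chosen). For a pair of sets the first boolean
    selects open pairs ([true]) or chosen edges ([false]), the second the sign of the deviation. *)
Let index := ((T * T + T * T + T * T) + ({set T} * {set T} * bool * bool))%type.
Let sg (b : bool) : R := if b then 1 else -1.
Let f (A B : {set T}) := between R (adj H) A B.

Let ok (k : index) := match k with
  | inl (inl (inl (u, v))) | inl (inl (inr (u, v))) | inl (inr (u, v)) => u != v
  | inr (A, B, _, _) => dense A B end.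
Let V (k : index) i (S : state T) : R := match k with
  | inl (inl (inl (u, v))) => codeg R S.2 S.2 u v / Q i ^+ 2
  | inl (inl (inr (u, v))) => codeg R S.1 S.2 u v / Q i
  | inl (inr (u, v)) => codeg R S.1 S.1 u v
  | inr (A, B, true, b) => sg b * (between R S.2 A B / Q i)
  | inr (A, B, false, b) => sg b * between R S.1 A B end.
(** Budget plus second-order cost, divided by [lam], is the permitted deviation: at most [n / 2] for
    open codegrees, [5 * m / 8] for mixed ones and [delta / 4 * f A B] for open pairs between
    sets. *)
Let lam (k : index) : R := match k with
  | inl (inl (inl _)) => 10 * L / n
  | inl (inl (inr _)) => 8 * L / m
  | inl (inr _) => 4^-1
  | inr (A, B, true, _) => 16 * s%:R * L / (delta * f A B)
  | inr (_, _, false, _) => delta / 96 end.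
Let drift (k : index) : R := match k with
  | inl (inl (inl _)) => 8 * n * w * (2 + z) * tau
  | inl (inl (inr _)) => (4 * n + 10 * m * w) * tau
  | inl (inr _) => 10 * m * tau
  | inr (A, B, true, _) => 0
  | inr (A, B, false, b) => sg b * ((1 + sg b * (delta / 4)) * f A B * tau) end.
Let om (k : index) : R := match k with
  | inl (inl (inl _)) => cX * tau
  | inl (inl (inr _)) => cY * tau
  | inl (inr _) => 10 * m * tau
  | inr (A, B, true, _) => cF * tau
  | inr (A, B, false, _) => 16 * (delta / 96) ^+ 2 * f A B * tau end.
Let bud (k : index) : R := match k with
  | inl _ => 4 * L
  | inr _ => 3 * s%:R * L end.

Let S0 : state T := (fun _ _ => false, adj H).

Let f_gt0 A B : dense A B -> 0 < f A B.
Proof. by case/and3P=> _ _; apply: lt_le_trans; rewrite mulr_gt0 // exprn_gt0. Qed.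

Let lam_gt0 k : ok k -> 0 < lam k.
Proof.
case: k => [[[uv|uv]|uv]|[[[A B] []] b]] /= okk; last exact: divr_gt0.
- by rewrite divr_gt0 // mulr_gt0.
- by rewrite divr_gt0 // mulr_gt0.
- by rewrite invr_gt0.
by rewrite divr_gt0 // !mulr_gt0 // f_gt0.
Qed.

Let codeg00 (A B : rel T) u v : (forall x y, A x y = false) -> codeg R A B u v = 0.
Proof. by move=> A0; apply: big1 => t _; rewrite A0 mul0r. Qed.

Let between0 A B : between R S0.1 A B = 0.
Proof. by apply: big1 => a _; apply: big1. Qed.

Record good i (S : state T) : Prop := Good {
  good_open : forall u v, u != v -> codeg R S.2 S.2 u v <= 2 * n * Q i ^+ 2;
  good_mixed : forall u v, u != v -> codeg R S.1 S.2 u v <= 5 * m * Q i;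
  good_edge : forall u v, u != v -> codeg R S.1 S.1 u v <= z;
  good_between : forall A B, dense A B ->
    `|between R S.2 A B / Q i - f A B| <= delta / 4 * f A B }.

Let conf i S := confined ok V S0 lam drift om bud i S.

Lemma cF_le : cF * rho <= s%:R * L.
Proof.
have h1 : cF * rho = 2816 * s%:R * (m * rho) / 6000 + 4 * rho * w ^+ 4 * s%:R * s%:R / h.
  rewrite /cF /thF; field; rewrite !gt_eqF //.
have h2 : 2816 * s%:R * (m * rho) / 6000 <= s%:R * L / 2.
  have := ler_wpM2l (ltW sR_gt0) m_rho; have := mulr_gt0 sR_gt0 L_gt0; lra.
have h3 : 4 * rho * w ^+ 4 * s%:R * s%:R / h <= s%:R * L / 2.
  rewrite ler_pdivrMr //; have := ler_wpM2l (ltW sR_gt0) h_rho; lra.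
lra.
Qed.

Lemma conf_good i S : (i <= N)%N -> conf i S -> good i S.
Proof.
move=> iN cS.
have Q0 := Q_gt0 i.
have bound k : ok k -> V k i S <=
    V k 0 S0 + drift k * i%:R + (bud k + om k * i%:R) / lam k.
  by move=> okk; exact: (confined_le okk (lam_gt0 okk) cS).
have omX k c X : 0 <= c -> om k = c * tau -> c * rho <= X -> om k * i%:R <= X.
  by move=> c0 -> cX'; exact: le_trans (tau_i c0 iN) cX'.
split=> [u v uv|u v uv|u v uv|A B dAB].
- have /= := bound (inl (inl (inl (u, v)))) uv.
  rewrite /Q expr0 expr1n divr1 -/(Q i) => hb.
  have c0 : codeg R (adj H) (adj H) u v <= n.
    rewrite /n -sum1_card natr_sum; apply: ler_sum => t _.
    by rewrite -ind_and ind_le1.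
  have h1 : 8 * n * w * (2 + z) * tau * i%:R <= n / 4.
    apply: le_trans (tau_i _ iN) _.
      by rewrite !mulr_ge0 ?(ltW n_gt0) ?(ltW w_gt0) // addr_ge0 // (le_trans ler01).
    have := ler_wpM2l (ltW n_gt0) rho_w; lra.
  have h2 : (4 * L + cX * tau * i%:R) / (10 * L / n) <= n / 2.
    rewrite ler_pdivrMr ?divr_gt0 ?mulr_gt0 //.
    have -> : n / 2 * (10 * L / n) = 5 * L by field; rewrite gt_eqF.
    have : cX * tau * i%:R <= L.
      apply: le_trans (tau_i _ iN) cX_le.
      by rewrite /cX !mulr_ge0 // invr_ge0.
    lra.
  rewrite -ler_pdivrMr ?exprn_gt0 //.
  move: hb h1 h2 c0; have := n_gt0.
  set a := _ / _ ^+ 2; set b := (_ + _) / _; lra.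
- have /= := bound (inl (inl (inr (u, v)))) uv.
  rewrite (@codeg00 (fun _ _ => false) _ _ _ (fun _ _ => erefl)) mul0r add0r => hb.
  have h1 : (4 * n + 10 * m * w) * tau * i%:R <= 4 * m + m / 6.
    apply: le_trans (tau_i _ iN) _.
      by rewrite addr_ge0 // !mulr_ge0.
    have -> : (4 * n + 10 * m * w) * rho = 4 * (n * rho) + 10 * m * (rho * w) by ring.
    rewrite n_rho lerD2l.
    have hr : 64 * (rho * w) <= 1.
      apply: le_trans rho_w.
      have r0 : 0 <= rho * w.
        by rewrite mulr_ge0 ?(ltW w_gt0) // -tauN mulr_ge0 // ltW.
      have := z_ge1; nra.
    have := ler_wpM2l (ltW m_gt0) hr; have := m_gt0; lra.
  have h2 : (4 * L + cY * tau * i%:R) / (8 * L / m) <= 5 * m / 8.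
    rewrite ler_pdivrMr ?divr_gt0 ?mulr_gt0 //.
    have -> : 5 * m / 8 * (8 * L / m) = 5 * L by field; rewrite gt_eqF.
    have : cY * tau * i%:R <= L.
      apply: le_trans (tau_i _ iN) cY_le.
      by rewrite /cY !mulr_ge0 ?invr_ge0 // addr_ge0 // mulr_ge0 // exprn_ge0.
    lra.
  rewrite -ler_pdivrMr //.
  move: hb h1 h2; have := m_gt0.
  set a := _ / _; set b := (_ + _) / _; lra.
- have /= := bound (inl (inr (u, v))) uv.
  rewrite (@codeg00 (fun _ _ => false) _ _ _ (fun _ _ => erefl)) add0r invrK => hb.
  have h1 : 10 * m * tau * i%:R <= L / 5.
    apply: le_trans (tau_i _ iN) _; first by rewrite mulr_ge0 // ltW.
    have := m_rho; lra.
  (* Drift [L / 5] plus [4 * (4 * L + L / 5)] is exactly [17 * L]. *)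
  rewrite /z; lra.
have fp := f_gt0 dAB.
have b2 b : sg b * (between R S.2 A B / Q i) <= sg b * f A B + delta / 4 * f A B.
  have /= := bound (inr (A, B, true, b)) dAB.
  rewrite /Q expr0 divr1 mul0r addr0 -/(Q i) => hb.
  apply: le_trans hb _; rewrite lerD2l.
  rewrite ler_pdivrMr ?divr_gt0 ?mulr_gt0 //.
  have -> : delta / 4 * f A B * (16 * s%:R * L / (delta * f A B)) = 4 * (s%:R * L).
    by field; rewrite !gt_eqF.
  have : cF * tau * i%:R <= s%:R * L.
    apply: le_trans (tau_i _ iN) cF_le.
    by rewrite /cF addr_ge0 // !mulr_ge0 ?invr_ge0 ?exprn_ge0 // ?mulr_ge0 // ltW.
  lra.
have := b2 true; have := b2 false; rewrite /sg => h1 h2.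
rewrite ler_norml; apply/andP; split; lra.
Qed.

(** The union bound: at most [3 * n ^+ 2] codegrees contribute [n ^- 4] each, and at most
    [4 * n ^+ (2 * s)] set quantities contribute [n ^- (3 * s)] each. *)
Lemma bud_small : \sum_(k | ok k) expR (- bud k) < 1.
Proof.
pose x := expR (- L).
have x0 : 0 < x by exact: expR_gt0.
have nx : n * x = 1 by rewrite -expL expRxMexpNx_1.
have x8 : x <= 8^-1.
  by rewrite -(ler_pM2l n_gt0) nx ler_pdivlMr // mul1r.
rewrite big_sumType /=.
have h1 : \sum_(i : T * T + T * T + T * T | ok (inl i)) expR (- (4 * L)) <= 3 * x ^+ 2.
  apply: (@le_trans _ _ (\sum_(i : T * T + T * T + T * T) expR (- (4 * L)))).
    by apply: ler_sum_sub => i; exact: expR_ge0.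
  rewrite sumr_const !card_sum !card_prod -mulrN -[expR _ *+ _]mulr_natr.
  have -> : expR (4 * - L) = x ^+ 4 by rewrite expRM_natl.
  rewrite !natrD !natrM -/n.
  have -> : x ^+ 4 * (n * n + n * n + n * n) = 3 * x ^+ 2 * (n * x) ^+ 2 by ring.
  by rewrite nx expr1n mulr1.
have h2 : \sum_(i : {set T} * {set T} * bool * bool | ok (inr i)) expR (- (3 * s%:R * L))
    <= 4 * x.
  pose D := [set A : {set T} | #|A| == s].
  apply: (@le_trans _ _ (\sum_(i in setX (setX (setX D D) [set: bool]) [set: bool])
      expR (- (3 * s%:R * L)))).
    rewrite big_mkcond [X in _ <= X]big_mkcond; apply: ler_sum => [[[[A B] b1] b2]] _.
    rewrite !inE /= /dense andbT andbT; case: ifP => [/and3P[-> -> _]//|_].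
    by case: ifP => // _; exact: expR_ge0.
  rewrite sumr_const !cardsX cardsT card_bool -[expR _ *+ _]mulr_natr.
  have -> : expR (- (3 * s%:R * L)) = (x ^+ s) ^+ 3.
    by rewrite -!expRM_natl; congr expR; ring.
  have hD : (#|D| * #|D| * 2 * 2)%:R <= 4 * (n ^+ s) ^+ 2.
    have : #|D|%:R <= n ^+ s by rewrite /n -natrX ler_nat card_sets_le.
    rewrite !natrM; have : 0 <= #|D|%:R :> R by exact: ler0n.
    nra.
  apply: le_trans (ler_wpM2l _ hD) _; first by rewrite !exprn_ge0 // ltW.
  have -> : (x ^+ s) ^+ 3 * (4 * (n ^+ s) ^+ 2) = 4 * x ^+ s * (n * x) ^+ s ^+ 2.
    by rewrite exprMn; ring.
  rewrite nx !expr1n mulr1 ler_pM2l // -[X in _ <= X]expr1.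
  apply: ler_wiXn2l => //; [exact: ltW|].
  by apply: le_trans x8 _; rewrite invf_le1 // ler1n.
apply: le_lt_trans (lerD h1 h2) _; nra.
Qed.

Section Step.
Variables (i : nat) (S : state T).
Hypothesis iN : (i < N)%N.
Hypothesis IS : valid H S.
Hypothesis gS : good i S.

(** The bounds in [good] use [Q i] while increments are normalised by [Q i.+1]; the ratio is at most
    2 because [eps <= 2^-1]. *)
Let r : R := Q i / Q i.+1.

Let r_ge0 : 0 <= r. Proof. by rewrite divr_ge0 // ltW. Qed.

Let r_le2 : r <= 2.
Proof.
rewrite /r -ler_pdivlMl // mulrC; exact: QSV.
Qed.

Let QiV : (Q i)^-1 <= w. Proof. exact: QV (ltnW iN). Qed.

Let QiV_ge0 : 0 <= (Q i)^-1. Proof. by rewrite invr_ge0 ltW. Qed.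

Let p_small : 2 * p i <= tau * w.
Proof. have := p_le (ltnW iN); lra. Qed.

(** The 11 in [eps]: mixed codegrees contribute [10 * m * tau], and adding the pair itself at most
    [tau * w <= tau * m]. *)
Lemma step_p_eps : p i * (2 + 4 * (5 * m * Q i)) <= eps.
Proof.
have -> : p i * (2 + 4 * (5 * m * Q i)) = 2 * p i + 10 * m * (2 * p i * Q i) by ring.
rewrite pQ /eps; have := p_small; have := ler_wpM2l (ltW tau_gt0) w_le_m; lra.
Qed.

Let mixed_ge0 : 0 <= 5 * m * Q i. Proof. by rewrite !mulr_ge0 // ltW. Qed.

Lemma step_controlled k : ok k ->
  step_control (weight (p i) eps S) (fun a => V k i.+1 (perform S a))
    (V k i.+1 S) (V k i S) (lam k) (drift k) (om k).
Proof.
have p0 := ltW (p_gt0 i); have Q0 := Q_gt0 i; have e0 := ltW eps_gt0.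
have hy := good_mixed gS; have hz := good_edge gS; have hpe := step_p_eps.
have Q1 := Q_gt0 i.+1.
have QE : Q i * (1 - eps) = Q i.+1 by rewrite QS.
have rE : Q i = r * Q i.+1 by rewrite /r; field; rewrite gt_eqF.
have r4 : r ^+ 2 <= 4 by have := r_ge0; have := r_le2; nra.
have rV : (Q i.+1)^-1 = r * (Q i)^-1 by rewrite /r; field; rewrite !gt_eqF.
have Q1V : (Q i.+1)^-1 <= 2 * w.
  by apply: le_trans (QSV _) _; rewrite ler_pM2l.
have Q1V0 : 0 <= (Q i.+1)^-1 by rewrite invr_ge0 ltW.
case: k => [[[[u v]|[u v]]|[u v]]|[[[A B] []] b]] /= okk.
- rewrite QS; apply: (control_open_codeg IS p0 hy hz mixed_ge0 z_ge1 hpe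
    Q0 e0 eps_le okk _ thX_le1 (good_open gS okk)); rewrite ?QE.
  + by rewrite divr_ge0 // mulr_ge0.
  + have -> : p i * (4 + 2 * z) * (2 * n * Q i ^+ 2) / Q i.+1 ^+ 2 =
       2 * p i * (2 * n * (2 + z)) * r ^+ 2 by rewrite {1}rE; field; rewrite gt_eqF.
    have c0 : 0 <= 2 * n * (2 + z) by rewrite !mulr_ge0 // addr_ge0 // (le_trans ler01).
    have -> : 8 * n * w * (2 + z) * tau = tau * w * (2 * n * (2 + z)) * 4 by ring.
    apply: ler_pM; rewrite ?sqr_ge0 //; first by rewrite mulr_ge0 // mulr_ge0.
    by rewrite ler_wpM2r.
  + have -> : (4 + 8 * (5 * m * Q i)) / Q i.+1 ^+ 2 =
       r ^+ 2 * (4 * (Q i)^-1 * (Q i)^-1 + 40 * m * (Q i)^-1).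
      rewrite rE; field; rewrite !gt_eqF //.
      by have := Q0; rewrite {1}rE pmulr_lgt0.
    have h1 : 4 * (Q i)^-1 * (Q i)^-1 + 40 * m * (Q i)^-1 <= 44 * m * w.
      have := ler_pM QiV_ge0 QiV_ge0 QiV QiV.
      have := ler_wpM2l m_ge0 QiV; have := ler_wpM2r w_ge0 w_le_m; lra.
    have h2 := ler_pM (sqr_ge0 r) _ r4 h1.
    have -> : thX = 10 * L / n * (4 * (44 * m * w)) by rewrite /thX; ring.
    apply: ler_wpM2l; first by rewrite divr_ge0 // mulr_ge0.
    by apply: h2; rewrite addr_ge0 // !mulr_ge0.
  have -> : 4 * thX * (10 * L / n * (2 * eps * (2 * n * Q i ^+ 2) / Q i.+1 ^+ 2)) =
      160 * thX * L * eps * r ^+ 2.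
    by rewrite {1}rE; field; rewrite !gt_eqF.
  have -> : cX * tau = 160 * thX * L * eps * 4 by rewrite /cX /eps; ring.
  by rewrite ler_wpM2l // !mulr_ge0 ?invr_ge0.
- rewrite QS; apply: (control_mixed_codeg IS p0 hy hz z_ge1 hpe
    Q0 e0 eps_le okk _ thY_le1 (good_open gS okk)); rewrite ?QE.
  + by rewrite divr_ge0 // mulr_ge0.
  + have -> : (2 * p i * (2 * n * Q i ^+ 2) + 2 * p i * (5 * m * Q i)) / Q i.+1 =
       (2 * p i * Q i) * (2 * n * r + 5 * m * (Q i.+1)^-1).
      by rewrite [in Q i ^+ 2]expr2 {2}rE; field; rewrite gt_eqF.
    rewrite pQ mulrC ler_pM2r //.
    have := ler_wpM2l n_ge0 r_le2; have := ler_wpM2l m_ge0 Q1V; lra.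
  + have -> : thY = 8 * L / m * ((4 + 4 * z) * (2 * w)) by rewrite /thY; ring.
    apply: ler_wpM2l; first by rewrite divr_ge0 // mulr_ge0.
    by apply: ler_wpM2l => //; have := z_ge1; lra.
  have -> : 4 * thY * (8 * L / m * ((2 * p i * (2 * n * Q i ^+ 2) + eps * (5 * m * Q i)) / Q i.+1))
     = 4 * thY * (8 * L / m) * (((2 * p i * Q i) * (2 * n) + 5 * m * eps) * r).
    rewrite [in Q i ^+ 2]expr2 {2 3}rE; field; rewrite !gt_eqF //.
  have -> : cY * tau = 4 * thY * (8 * L / m) * ((tau * (2 * n) + 5 * m * eps) * 2).
    by rewrite /cY /eps; ring.
  rewrite pQ; apply: ler_wpM2l.
    by apply: mulr_ge0; [rewrite mulr_ge0|rewrite divr_ge0 // mulr_ge0].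
  apply: ler_wpM2l => //; apply: addr_ge0; first by rewrite !mulr_ge0.
  by apply: mulr_ge0 => //; rewrite mulr_ge0.
- apply: (control_edge_codeg IS p0 hy hpe okk);
    rewrite -(pQ i); lra.
- have fp := f_gt0 okk.
  have hW : between R S.2 A B <= 2 * f A B * Q i.
    rewrite -ler_pdivrMr //; have := good_between gS okk.
    by rewrite ler_norml => /andP[_]; have := ler_wpM2r (ltW fp) delta_le1; lra.
  (* The density [f A B >= gamma * s ^+ 2] enters here and makes the scaled jumps uniform in [A] and
     [B]. *)
  have lam_le : 16 * s%:R * L / (delta * f A B) <= 16 * L / (delta * gamma * s%:R).
    have -> : 16 * L / (delta * gamma * s%:R) = 16 * s%:R * L / (delta * (gamma * s%:R ^+ 2)).
      by field; rewrite !gt_eqF.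
    rewrite ler_pM2l ?mulr_gt0 // lef_pV2 ?posrE ?mulr_gt0 ?exprn_gt0 // ler_pM2l //.
    by case/and3P: okk.
  have l0 : 0 <= 16 * s%:R * L / (delta * f A B).
    by rewrite divr_ge0 // ?mulr_ge0 // ltW.
  have [/eqP cA /eqP cB _] := and3P okk.
  rewrite QS; apply: (control_open_between IS p0 hy mixed_ge0 hpe
    Q0 e0 eps_le _ l0 thF_le1 h_ge0 hW (w := w)); rewrite ?QE.
  + by rewrite /sg; case: b; rewrite ?normrN normr1.
  + have -> : thF = 16 * L / (delta * gamma * s%:R) * ((6 * h) * (2 * w)).
      by rewrite /h; field; rewrite !gt_eqF.
    apply: ler_pM => //; first by rewrite mulr_ge0 // addr_ge0 // mulr_ge0.
    apply: ler_pM => //; first by rewrite addr_ge0 // mulr_ge0.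
    by have := h_ge1; lra.
  + apply: le_trans jump; rewrite ler_expR.
    have -> : 704 * m * L / (delta * gamma * s%:R) = 16 * L / (delta * gamma * s%:R) * (44 * m).
      by field; rewrite !gt_eqF.
    apply: ler_pM => //; first by rewrite mulr_ge0 // addr_ge0 // mulr_ge0.
    have -> : (2 + 4 * (5 * m * Q i)) / Q i.+1 = 2 * (Q i.+1)^-1 + 20 * m * r.
      by rewrite {1}rE; field; rewrite gt_eqF.
    have := ler_wpM2l m_ge0 r_le2; have := w_le_m; have := Q1V; lra.
  have hA : forall X : {set T}, #|X| = s -> heavy S.1 X h <= 2 * s%:R / h.
    move=> X cX'; rewrite ler_pdivlMr // -cX'.
    by apply: (heavy_le hz) => //; [exact: le_trans z_ge1|rewrite cX'].
  have -> : cF * tau = 4 * thF * (16 * s%:R * L / (delta * f A B) * (eps * (2 * f A B) * 2))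
      + tau * w / 2 * w ^+ 3 * (2 * (s%:R * (2 * s%:R / h) + s%:R * (2 * s%:R / h))).
    by rewrite /cF /eps; field; rewrite !gt_eqF.
  apply: lerD.
    apply: ler_wpM2l; first by rewrite mulr_ge0 // ltW.
    apply: ler_wpM2l => //.
    have -> : eps * (2 * f A B * Q i) / Q i.+1 = eps * (2 * f A B) * r.
      by rewrite {1}rE; field; rewrite gt_eqF.
    by rewrite ler_wpM2l // !mulr_ge0 // ltW.
  apply: ler_pM.
  + by rewrite mulr_ge0 // exprn_ge0.
  + by rewrite mulr_ge0 // addr_ge0 // mulr_ge0 // heavy_ge0.
  + by apply: ler_wpM2r; [rewrite exprn_ge0|have := p_small; lra].
  rewrite ler_pM2l // cA cB; apply: lerD; rewrite ler_pM2l //; exact: hA.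
have fp := f_gt0 okk.
have := good_between gS okk; rewrite ler_norml => /andP[g1 g2].
have hW : between R S.2 A B <= 2 * f A B * Q i.
  by rewrite -ler_pdivrMr //; have := ler_wpM2r (ltW fp) delta_le1; lra.
apply: (control_edge_between IS p0 hy hpe _ _ _ hW).
- by rewrite /sg; case: b; rewrite ?normrN normr1.
- by rewrite divr_ge0.
- by have := delta_le1; lra.
- have -> : 2 * p i * between R S.2 A B = tau * (between R S.2 A B / Q i).
    by rewrite -(pQ i); field; rewrite gt_eqF.
  have t1 := ler_wpM2l (ltW tau_gt0) g1; have t2 := ler_wpM2l (ltW tau_gt0) g2.
  by rewrite /sg; case: b; lra.
have -> : 2 * p i * (2 * f A B * Q i) = (2 * p i * Q i) * (2 * f A B) by ring.
by rewrite pQ; lra.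
Qed.

Lemma step_weight_ge0 a : 0 <= weight (p i) eps S a.
Proof. exact: (weight_ge0 IS (ltW (p_gt0 i)) (good_mixed gS) step_p_eps). Qed.

Lemma step_weight_le1 : \sum_a weight (p i) eps S a <= 1.
Proof.
apply: (sum_weight_le1 _ (ltW (p_gt0 i)) (ltW eps_gt0)).
apply: le_trans prob; rewrite ler_wpM2l ?exprn_ge0 // lerD2r.
have := p_small; have := p_gt0 i; lra.
Qed.

End Step.

(** The drift allows a relative error [delta / 4] and the second-order cost adds [delta / 6],
    together [5 / 12 * delta]. The additive error is the budget [3 * s * L] divided by
    [lam = delta / 96]. *)
Lemma process_result : exists2 S, valid H S & forall A B, dense A B ->
  `|between R S.1 A B - rho * f A B| <=
    5 / 12 * delta * (rho * f A B) + 288 * s%:R * L / delta.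
Proof.
have [S [IS cS]] : exists S, valid H S /\ conf N S.
  apply: (process_end (next := @perform T) (P := fun i => weight (p i) eps)).
  - exact: valid_start.
  - by move=> k /lam_gt0/ltW.
  - exact: bud_small.
  - move=> i S iN IS cS; apply: step_weight_ge0 => //; exact: conf_good (ltnW iN) cS.
  - move=> i S iN IS cS; apply: step_weight_le1 => //; exact: conf_good (ltnW iN) cS.
  - move=> i S a _ IS Wa; apply: valid_perform => //; exact: weight_gt0_O Wa.
  move=> i S k iN IS cS okk.
  by apply: step_controlled => //; exact: conf_good (ltnW iN) cS.
exists S => // A B dAB.
have fp := f_gt0 dAB.
have b2 b : sg b * between R S.1 A B <=
    sg b * rho * f A B + 5 / 12 * delta * (rho * f A B) + 288 * s%:R * L / delta.
  have okk : ok (inr (A, B, false, b)) by [].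
  have /= := confined_le okk (lam_gt0 okk) cS.
  rewrite between0 mulr0 add0r => hb; apply: le_trans hb _.
  have -> : sg b * ((1 + sg b * (delta / 4)) * f A B * tau) * N%:R =
     sg b * (1 + sg b * (delta / 4)) * f A B * (tau * N%:R) by ring.
  have -> : (3 * s%:R * L + 16 * (delta / 96) ^+ 2 * f A B * tau * N%:R) / (delta / 96) =
     288 * s%:R * L / delta + delta / 6 * f A B * (tau * N%:R).
    by field; rewrite gt_eqF.
  rewrite tauN le_eqVlt; apply/orP; left; apply/eqP.
  by rewrite /sg {okk}; case: b; field; rewrite gt_eqF.
have := b2 true; have := b2 false; rewrite /sg => h1 h2.
rewrite ler_norml; apply/andP; split; lra.
Qed.

End Assembly.

(** * Choice of the parameters *)

(** [L = ln n] reaches [40 * |W| + 6400]. The first summand gives [W <= L / 40]; the second gives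
    [80 <= L / 80], hence [L <= (L / 80) ^+ 2 <= expR (L / 40)]. *)
Lemma expR_ln_large (R : realType) (W : R) : exists n0 : nat, forall n : nat,
  (n0 <= n)%N -> [/\ expR (ln n%:R) = n%:R :> R, 1 <= ln n%:R :> R,
    W <= expR (ln n%:R / 40) & ln n%:R <= expR (ln n%:R / 40) :> R].
Proof.
pose X : R := 40 * `|W| + 80 * 80; exists (Num.bound (expR X)) => n hn.
have Xn : expR X <= n%:R.
  by apply: ltW; apply: lt_le_trans (archi_boundP (expR_ge0 X)) _; rewrite ler_nat.
have n0 : 0 < n%:R :> R by exact: lt_le_trans (expR_gt0 _) Xn.
have lnE : expR (ln n%:R) = n%:R :> R by rewrite lnK.
move: Xn; rewrite -{1}lnE ler_expR; set L := ln _ => XL.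
have L80 : 80 <= L / 80.
  by rewrite ler_pdivlMr //; apply: le_trans XL; rewrite /X lerDr mulr_ge0.
have WL : W <= L / 40.
  rewrite ler_pdivlMr // mulrC; apply: le_trans XL.
  apply: (@le_trans _ _ (40 * `|W|)); first by rewrite ler_pM2l // ler_norm.
  by rewrite /X lerDl mulr_ge0.
clear XL; split=> //; first by lra.
  by apply: le_trans WL _; have := expR_ge1Dx (L / 40); lra.
have hy : L / 80 <= expR (L / 80) by have := expR_ge1Dx (L / 80); lra.
have -> : expR (L / 40) = expR (L / 80) * expR (L / 80).
  by rewrite -expRD; congr expR; field.
apply: (@le_trans _ _ (L / 80 * (L / 80))); last by apply: ler_pM => //; lra.
have LE : L = 80 * (L / 80) by field.
by rewrite {1}LE; apply: ler_wpM2r => //; apply: le_trans L80.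
Qed.

Lemma expR_le_1B (R : realType) (e : R) : 0 <= e -> e <= 2^-1 ->
  expR (- (2 * e)) <= 1 - e.
Proof.
move=> e0 e1; rewrite expRN -[1 - e]invrK lef_pV2 ?posrE ?expR_gt0 ?invr_gt0 //; last by lra.
apply: le_trans (expR_ge1Dx _); rewrite -[X in X <= _]mul1r ler_pdivrMr; last by lra.
by nra.
Qed.

(* [b], [l] and [w] stand for the square roots of [beta] and [ln n] and for
   [n] to the power 1/40; the exponent 40 leaves room for all error terms. *)
Lemma process_asymptotics (R : realType) (T : finType) (H : sgraph T)
    (beta gamma delta C b l L w : R) (s : nat) :
  0 < gamma -> gamma <= 1 -> 0 < delta -> delta <= 1 ->
  0 < b -> b ^+ 2 = beta -> 880 * beta <= 1 ->
  500 <= C * (delta ^+ 2 * b * gamma) ->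
  1 <= l -> l ^+ 2 = L -> expR L = #|T|%:R -> w = expR (L / 40) ->
  L <= w -> 8000 <= w -> b^-1 <= w -> (delta ^+ 2 * gamma) ^- 2 <= w ->
  C * l * w ^+ 20 <= s%:R ->
  exists2 S : state T, valid H S & forall A B, dense H gamma s A B ->
    `|between R S.1 A B - b * l / w ^+ 20 * between R (adj H) A B| <=
    delta * (b * l / w ^+ 20 * between R (adj H) A B).
Proof.
move=> g0 g1 d0 d1 b0 bb b1 hC l1 lL eL wE Lw w1 bw kw hs.
pose k := delta ^+ 2 * gamma.
(* [K] gathers the denominators 192 and 6000 of [h] and [thF], hidden behind a variable. *)
have [K KE] : exists K : R, K = 192 * 6000 by exists (192 * 6000).
have K0 : 0 < K by rewrite KE mulr_gt0.
have cw c : (c <= 8000)%N -> c%:R <= w.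
  by move=> c8; apply: le_trans w1; rewrite ler_nat.
have w11 : 1 <= w by exact: (cw 1%N).
have K_w2 : K <= w ^+ 2.
  by rewrite KE expr2; 
  exact: (ler_pM (ler0n R 192) (ler0n R 6000) (cw 192%N isT) (cw 6000%N isT)).
clear w1.
have k0 : 0 < k by rewrite mulr_gt0 // exprn_gt0.
have k1 : k <= 1.
  by rewrite /k mulr_ile1 ?(ltW g0) ?exprn_ge0 ?exprn_ile1 // ltW.
have L1 : 1 <= L by rewrite -lL exprn_ege1.
have L0 : 0 < L by exact: lt_le_trans L1.
have l0 : 0 < l by exact: lt_le_trans l1.
have lleL : l <= L by rewrite -lL expr2 ler_peMl // ltW.
have w0 : 0 < w by exact: lt_le_trans w11.
have bleq : b <= 1.
  rewrite -(@ler_pXn2r _ 2) ?nnegrE ?(ltW b0) // bb expr1n.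
  by move: (sqr_ge0 b) b1; rewrite bb; clear; lra.
have wp i : 0 < w ^+ i by rewrite exprn_gt0.
set n : R := #|T|%:R in eL *.
have nE : n = w ^+ 40 by rewrite -eL wE -expRM_natl; congr expR; field.
have n0 : 0 < n by rewrite nE.
pose v := w ^+ 20; have v0 : 0 < v by exact: wp.
have nv : n = v * v by rewrite nE -exprD.
pose rho' := b * l / v; pose m := b * l * v.
have r0 : 0 < rho' by rewrite divr_gt0 // mulr_gt0.
have m0 : 0 < m by rewrite !mulr_gt0.
have nrho : n * rho' = m by rewrite /rho' /m nv; field; rewrite gt_eqF.
have mrho : m * rho' = beta * L.
  by rewrite /m /rho' -bb -lL; field; rewrite gt_eqF.
have mn : m / n = rho' by rewrite /m /rho' nv; field; rewrite gt_eqF.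
have be0 : 0 < beta by rewrite -bb exprn_gt0.
have bw1 : 1 <= b * w by rewrite -ler_pdivrMl // mulr1.
have hm : w ^+ 19 <= m.
  have -> : m = w ^+ 19 * (b * w) * l by rewrite /m /v exprSr; ring.
  rewrite -mulrA ler_peMr ?(ltW (wp _)) // -[1]mulr1; apply: ler_pM => //.
have hr : rho' * w ^+ 19 <= 1.
  have -> : rho' * w ^+ 19 = b * (l / w).
    by rewrite /rho' /v exprSr; field; rewrite gt_eqF // gt_eqF.
  rewrite mulr_ile1 ?(ltW b0) // ?divr_ge0 ?(ltW l0) ?(ltW w0) //.
  by rewrite ler_pdivrMr // mul1r (le_trans lleL).
have wle i j : (i <= j)%N -> w ^+ i <= w ^+ j by exact: ler_weXn2l.
(* The tool for several smallness conditions below: [rho'] is at most [w ^- 19], so any factor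
   bounded by a lower power of [w] is absorbed. *)
have rw c i : 0 <= c -> c <= w ^+ i -> (i <= 19)%N -> rho' * c <= 1.
  move=> c0 ci i19; apply: le_trans hr; rewrite ler_pM2l //.
  exact: le_trans ci (wle _ _ i19).
have kk : 1 <= k ^+ 2 * w.
  by rewrite -ler_pdivrMl ?exprn_gt0 // mulr1.
have kw1 : 1 <= k * w.
  by apply: (le_trans kk); rewrite ler_pM2r // expr2 ler_piMr // ltW.
have Ck : 500 <= C * k * b.
  by have -> : C * k * b = C * (delta ^+ 2 * b * gamma) by rewrite /k; ring.
have Ckb0 : 0 < C * k * b by apply: lt_le_trans Ck.
have Ck0 : 0 < C * k by rewrite -(pmulr_lgt0 _ b0).
have C0 : 0 < C by rewrite -(pmulr_lgt0 _ k0).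
have Ck1 : 1 <= C * k.
  apply: (@le_trans _ _ 500); first by rewrite ler1n.
  by apply: le_trans Ck _; rewrite ler_piMr // ltW.
have C1 : 1 <= C by apply: le_trans Ck1 _; rewrite ler_piMr // ltW.
have sC : C * w ^+ 20 <= s%:R.
  by apply: le_trans hs; rewrite ler_pM2r ?wp // ler_peMr // ltW.
have s1 : w ^+ 20 <= s%:R.
  by apply: le_trans sC; rewrite ler_peMl ?(ltW (wp _)).
have sp : 0 < s%:R :> R by exact: lt_le_trans (wp 20%N) s1.
have ks : w ^+ 20 <= k * s%:R.
  have h : k * (C * w ^+ 20) <= k * s%:R by rewrite ler_pM2l.
  by apply: le_trans h; rewrite mulrA ler_peMl ?(ltW (wp _)) // mulrC.
pose h := k * s%:R / (K * L ^+ 2 * w).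
have hE : delta / (6000 * L) * delta * gamma * s%:R / (192 * L * w) = h.
  by rewrite /h /k KE; field; rewrite !gt_eqF.
have Lw2 : L ^+ 2 <= w ^+ 2 by rewrite ler_pXn2r ?nnegrE ?(ltW L0) ?(ltW w0).
have L20 : 0 < L ^+ 2 by rewrite exprn_gt0.
have L2w : K * L ^+ 2 * w <= w ^+ 5.
  have -> : w ^+ 5 = w ^+ 2 * w ^+ 2 * w by ring.
  by rewrite ler_pM2r //; apply: ler_pM => //; exact: ltW.
have L2w0 : 0 < K * L ^+ 2 * w by rewrite !mulr_gt0.
pose thX := 1760 * L * m * w / n.
have thXE : thX = 1760 * L * w * rho' by rewrite -mn /thX; field; rewrite gt_eqF.
have thX0 : 0 < thX by rewrite thXE mulr_gt0 // !mulr_gt0.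
have hthX : 8 * L * thX <= 1.
  have -> : 8 * L * thX = rho' * (8 * 1760 * (L ^+ 2 * w)) by rewrite thXE; ring.
  apply: (rw _ 5%N) => //; first by rewrite !mulr_ge0 // ltW.
  have -> : w ^+ 5 = w * w * (w ^+ 2 * w) by ring.
  apply: ler_pM; rewrite ?(ltW (mulr_gt0 L20 w0)) ?mulr_ge0 //.
    by apply: ler_pM => //; exact: cw.
  by rewrite ler_pM2r.
pose thY := 64 * L * w * (1 + 17 * L) / m.
have thY0 : 0 < thY by rewrite divr_gt0 // !mulr_gt0 // addr_gt0 // mulr_gt0.
have hthY : 160 * w * thY <= 1.
  rewrite /thY mulrA ler_pdivrMr // mul1r; apply: le_trans hm.
  apply: (@le_trans _ _ (w ^+ 6)); last exact: wle.
  have h1 : 1 + 17 * L <= 18 * w by move: w11 Lw; clear; lra.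
  have -> : w ^+ 6 = (w * w) * (w * L * w) * w + (w * w * w * w * (w - L)) * w by ring.
  have -> : 160 * w * (64 * L * w * (1 + 17 * L)) = (160 * 64) * (w * L * w) * (1 + 17 * L) by ring.
  have c0 : 0 <= 160 * 64 * (w * L * w) by rewrite !mulr_ge0 // ltW.
  apply: le_trans (ler_wpM2l c0 h1) _.
  have -> : 160 * 64 * (w * L * w) * (18 * w) = 160 * 1152 * (w * L * w) * w by ring.
  apply: (@le_trans _ _ (w * w * (w * L * w) * w)); last first.
    by rewrite lerDl !mulr_ge0 ?(ltW w0) // subr_ge0.
  rewrite ler_pM2r // ler_pM2r ?mulr_gt0 //; apply: ler_pM => //; exact: cw.
(* Having more than [E] steps makes the total weight at most 1 (first term), [eps] at most [2^-1]
   (second term) and [N] positive (last term). *)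
pose E := n ^+ 2 * (rho' * w + 11 * m * rho') + 22 * m * rho' + 1.
have w00 := ltW w0; have r00 := ltW r0; have m00 := ltW m0; have n00 := ltW n0.
have mr0 : 0 <= 11 * m * rho' by apply: mulr_ge0 => //; exact: mulr_ge0.
have mr1 : 0 <= 22 * m * rho' by apply: mulr_ge0 => //; exact: mulr_ge0.
have rw0 : 0 <= rho' * w by exact: mulr_ge0.
have nn0 : 0 <= n ^+ 2 * (rho' * w + 11 * m * rho').
  by apply: mulr_ge0; [exact: exprn_ge0|exact: addr_ge0].
have E1 : 1 <= E by rewrite lerDr addr_ge0.
have E0 : 0 < E by apply: lt_le_trans E1.
pose N := Num.bound E.
have EN : E < N%:R by apply: archi_boundP; exact: ltW.
have N0 : 0 < N%:R :> R by exact: lt_trans EN.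
pose tau := rho' / N%:R.
have tauN : tau * N%:R = rho' by rewrite /tau; field; rewrite gt_eqF.
have tau0 : 0 < tau by rewrite divr_gt0.
have eps0 : 0 <= 11 * m * tau.
  by apply: mulr_ge0; [exact: mulr_ge0|exact: ltW].
have eps2 : 11 * m * tau <= 2^-1.
  rewrite /tau mulrA ler_pdivrMr //.
  suff : 22 * m * rho' <= N%:R by move=> h'; move: h'; clear; set x := m * rho'; lra.
  by apply: le_trans (ltW EN); rewrite /E -addrA addrCA lerDl addr_ge0.
have [S IS hS] : exists2 S, valid H S & forall A B, dense H gamma s A B ->
  `|between R S.1 A B - rho' * between R (adj H) A B| <=
    5 / 12 * delta * (rho' * between R (adj H) A B) + 288 * s%:R * L / delta.
  apply: (@process_result R T H m rho' tau L w gamma delta N s) => //.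
  - by apply: le_trans hm; have := wle 1%N 19%N isT; rewrite expr1.
  - rewrite -/n nE; apply: le_trans (cw 8%N isT) _.
    by have := wle 1%N 40%N isT; rewrite expr1.
  - by rewrite -(ltr0n R).
  (* By [expR_le_1B], the final proportion is at least [n ^ (- 22 * beta)], and [880 * beta <= 1]
     makes this at least [n ^ (- 1 / 40)]. *)
  - have hh : expR (- (22 * beta * L)) <= (1 - 11 * m * tau) ^+ N.
      have -> : - (22 * beta * L) = N%:R * (- (2 * (11 * m * tau))).
        have -> : N%:R * - (2 * (11 * m * tau)) = - (22 * (m * (tau * N%:R))) by ring.
        by rewrite tauN mrho mulrA.
      rewrite expRM_natl; apply: lerXn2r; rewrite ?nnegrE ?expR_ge0 //.
        by apply: le_trans (expR_ge0 _) (expR_le_1B eps0 eps2).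
      exact: expR_le_1B.
    apply: le_trans hh; rewrite wE -expRN ler_expR lerN2 mulrC ler_pM2l //.
    by move: b1; clear; lra.
  - rewrite -/n /tau.
    have -> : n ^+ 2 * (rho' / N%:R * w + 11 * m * (rho' / N%:R)) =
      n ^+ 2 * (rho' * w + 11 * m * rho') / N%:R by field; rewrite gt_eqF.
    rewrite ler_pdivrMr // mul1r; apply: le_trans (ltW EN); rewrite /E.
    by rewrite -addrA lerDl addr_ge0.
  - have -> : 32 * rho' * w * (2 + 17 * L) = rho' * (w * (64 + 544 * L)) by ring.
    apply: (rw _ 3%N) => //; first by rewrite mulr_ge0 ?addr_ge0 ?mulr_ge0 // ltW.
    rewrite exprS ler_pM2l //.
    apply: (@le_trans _ _ (608 * w)); first by move: L1 Lw; clear; lra.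
    by rewrite expr2 ler_pM2r //; exact: cw.
  - rewrite mrho mulrA -[X in _ <= X]mul1r ler_pM2r //.
    by move: b1 be0; clear; lra.
  - apply: le_trans hthX; rewrite ler_peMl ?(ltW thX0) //.
    by move: L1; clear; lra.
  - rewrite -/n -/thX.
    have -> : 640 * thX * L * (11 * m) * rho' = 880 * (m * rho') * (8 * L * thX) by ring.
    rewrite mrho; have c0 : 0 <= 880 * (beta * L) by rewrite !mulr_ge0 // ltW.
    apply: le_trans (ler_wpM2l c0 hthX) _.
    by rewrite mulr1 mulrA -[X in _ <= X]mul1r ler_pM2r.
  - apply: le_trans hthY; rewrite ler_peMl ?(ltW thY0) //.
    by move: w11; clear; lra.
  - rewrite -/n -/thY.
    have -> : 32 * thY * (L / m) * (4 * n + 110 * m ^+ 2) * rho' =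
       L * (thY * (32 * (4 * (n * rho' / m) + 110 * (m * rho')))).
      by field; rewrite gt_eqF.
    rewrite nrho mrho divff ?gt_eqF // mulr1 ler_piMr ?(ltW L0) //.
    apply: le_trans hthY; rewrite mulrC ler_pM2r //.
    have : 880 * (beta * L) <= L by rewrite mulrA -[X in _ <= X]mul1r ler_pM2r.
    by move: w11 Lw; clear; lra.
  - rewrite hE /h ler_pdivlMr // mul1r.
    by apply: le_trans ks; apply: le_trans L2w _; exact: wle.
  - rewrite hE /h expr_div_n ler_pdivlMr ?exprn_gt0 //.
    have -> : 2 * s%:R * (17 * L) * (K * L ^+ 2 * w) ^+ 2 =
      s%:R * (34 * L * (K * L ^+ 2 * w) ^+ 2) by ring.
    have -> : (k * s%:R) ^+ 2 = s%:R * (k ^+ 2 * s%:R) by ring.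
    rewrite ler_pM2l //.
    have hsq : (K * L ^+ 2 * w) ^+ 2 <= (w ^+ 5) ^+ 2.
      by rewrite ler_pXn2r ?nnegrE // ltW.
    apply: (@le_trans _ _ (w ^+ 19)).
      apply: (@le_trans _ _ (w * w * (w ^+ 5) ^+ 2)).
        apply: ler_pM; rewrite ?sqr_ge0 ?mulr_ge0 ?(ltW L0) //.
        by apply: ler_pM => //; [exact: ltW|exact: cw].
      have -> : w * w * (w ^+ 5) ^+ 2 = w ^+ 12 by ring.
      exact: wle.
    apply: (@le_trans _ _ (k ^+ 2 * w * w ^+ 19)); first by rewrite ler_peMl ?(ltW (wp _)) ?kk.
    by rewrite -mulrA -exprS ler_pM2l ?exprn_gt0.
  - rewrite hE /h mulrA ler_pdivlMr //.
    have -> : 8 * rho' * w ^+ 4 * s%:R * (K * L ^+ 2 * w) =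
      L * s%:R * (rho' * (8 * (K * (L * w ^+ 5)))) by ring.
    have -> : L * (k * s%:R) = L * s%:R * k by ring.
    rewrite ler_pM2l ?mulr_gt0 //.
    have h1 : rho' * (8 * (K * (L * w ^+ 5))) * w <= 1.
      rewrite -mulrA; apply: (rw _ 10%N) => //.
        by rewrite !mulr_ge0 ?exprn_ge0 // ltW.
      have -> : w ^+ 10 = w * (w ^+ 2 * (w * w ^+ 5)) * w by ring.
      rewrite ler_pM2r //; apply: ler_pM;
        rewrite ?mulr_ge0 ?exprn_ge0 ?(ltW L0) ?(ltW w0) ?(ltW K0) //.
        exact: cw.
      by apply: ler_pM; rewrite ?mulr_ge0 ?exprn_ge0 ?(ltW L0) ?(ltW w0) ?(ltW K0) // ler_pM2r.
    by rewrite -(ler_pM2r w0); apply: le_trans h1 kw1.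
  rewrite [X in _ <= X]wE ler_expR.
  have -> : 704 * m * L / (delta * gamma * s%:R) = L * (704 * m / (delta * gamma * s%:R)).
    by field; rewrite !gt_eqF.
  rewrite ler_pM2l // ler_pdivrMr ?mulr_gt0 // [40^-1 * _]mulrC ler_pdivlMr //.
  (* The lower bound on [C] gives [500 <= delta * gamma * C * b], while [40 * 704 * b ^+ 2 = 32 *
     (880 * beta) <= 32]. *)
  have h1 : 40 * 704 * b <= delta * gamma * C.
    have h2 : 500 <= delta * gamma * C * b.
      apply: le_trans Ck _.
      have -> : C * k * b = delta * (delta * gamma * C * b) by rewrite /k; ring.
      by rewrite ler_piMl // !mulr_ge0 // ltW.
    rewrite -(ler_pM2r b0); apply: le_trans h2.
    have -> : 40 * 704 * b * b = 32 * (880 * b ^+ 2) by ring.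
    by rewrite bb; move: b1; clear; lra.
  have h3 : 40 * 704 * b * (l * v) <= delta * gamma * C * (l * v).
    by rewrite ler_pM2r // mulr_gt0.
  have h4 : delta * gamma * (C * l * v) <= delta * gamma * s%:R.
    by rewrite ler_pM2l ?mulr_gt0.
  apply: le_trans h4.
  have -> : delta * gamma * (C * l * v) = delta * gamma * C * (l * v) by ring.
  apply: le_trans h3; rewrite le_eqVlt /m; apply/orP; left; apply/eqP; ring.
exists S => // A B dAB; apply: le_trans (hS A B dAB) _.
set f := between _ _ _ _.
have hf : gamma * s%:R ^+ 2 <= f by case/and3P: dAB.
(* The lower bounds on [C] and [f] give [500 * L * s <= delta ^+ 2 * (rho' * f)]. As
   [288 * 12 / 7 < 500], the additive error fits into the remaining [7 / 12] of the tolerance. *)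
have h1 : 500 * L <= k * (rho' * s%:R).
  apply: (@le_trans _ _ (k * (rho' * (C * l * v)))); last by rewrite ler_pM2l // ler_pM2l.
  have -> : k * (rho' * (C * l * v)) = C * k * b * L.
    by rewrite /rho' -lL; field; rewrite gt_eqF.
  by rewrite ler_pM2r.
have h2 : 500 * L * s%:R <= delta ^+ 2 * (rho' * f).
  apply: (@le_trans _ _ (k * (rho' * s%:R) * s%:R)); first by rewrite ler_pM2r.
  have -> : k * (rho' * s%:R) * s%:R = delta ^+ 2 * (rho' * (gamma * s%:R ^+ 2)).
    by rewrite /k; ring.
  by rewrite ler_pM2l ?exprn_gt0 // ler_pM2l.
have h3 : 288 * s%:R * L / delta <= 7 / 12 * (delta * (rho' * f)).
  rewrite ler_pdivrMr //.
  have -> : 7 / 12 * (delta * (rho' * f)) * delta = 7 / 12 * (delta ^+ 2 * (rho' * f)) by ring.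
  by move: h2 (mulr_gt0 L0 sp); clear; set x := delta ^+ 2 * _; lra.
rewrite -/v -/rho' -mulrA; move: h3; clear.
set x := delta * _; set y := _ / delta; lra.
Qed.

(** * Edge counts as ordered sums, and the final theorem *)

Lemma edges_betweenE (R : realType) (T : finType) (F : sgraph T) (A B : {set T}) :
  [disjoint A & B] -> (edges_between F A B)%:R = between R (adj F) A B.
Proof.
move=> AB.
pose P := [set p : T * T | [&& p.1 \in A, p.2 \in B & F p.1 p.2]].
(* Disjointness leaves each edge just one orientation from [A] to [B], so forgetting the order is
   injective on [P]. *)
have -> : edges_between F A B = #|P|.
  rewrite /edges_between -(@card_in_imset _ _ (fun p : T * T => [set p.1; p.2]) (mem P)).
    congr #|pred_of_set _|; apply/setP => e; rewrite inE; apply/andP/imsetP.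
      case=> /imsetP[[x y]]; rewrite inE /= => Fxy -> /existsP[a /andP[aA]].
      case/existsP=> b /andP[bB /eqP e2].
      have ab : a != b by apply: contraTneq bB => <-; rewrite (disjointFr AB aA).
      exists (a, b) => //; rewrite inE /= aA bB /=.
      have : a \in [set x; y] by rewrite e2 !inE eqxx.
      have : b \in [set x; y] by rewrite e2 !inE eqxx orbT.
      rewrite !inE => /orP[]/eqP b1 /orP[]/eqP a1; move: ab; rewrite a1 b1 ?eqxx //.
      by rewrite adj_sym.
    case=> [[x y]]; rewrite inE /= => /and3P[xA yB Fxy] ->; split.
      by apply/imsetP; exists (x, y); rewrite ?inE.
    by apply/existsP; exists x; rewrite xA; apply/existsP; exists y; rewrite yB /=.
  move=> [x y] [x' y']; rewrite !inE /= => /and3P[xA yB _] /and3P[x'A y'B _] e.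
  have : x \in [set x'; y'] by rewrite -e !inE eqxx.
  have : y \in [set x'; y'] by rewrite -e !inE eqxx orbT.
  rewrite !inE => /orP[]/eqP y1.
    by move: yB; rewrite y1 (disjointFr AB x'A).
  case/orP=> /eqP x1; first by rewrite x1 y1.
  by move: y'B; rewrite -x1 (disjointFr AB xA).
rewrite -sum_ind_mem (eq_bigr (fun p : T * T =>
  ((p.1 \in A)%:R : R) * ((p.2 \in B)%:R * (F p.1 p.2)%:R))).
  rewrite -(pair_bigA _ (fun x y => (x \in A)%:R * ((y \in B)%:R * (F x y)%:R))) /=.
  rewrite /between [RHS]big_mkcond; apply: eq_bigr => x _; rewrite -big_distrr /=.
  case: (x \in A); rewrite ?mul0r // mul1r [RHS]big_mkcond; apply: eq_bigr => y _.
  by case: (y \in B); rewrite ?mul0r ?mul1r.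
by move=> [x y] _; rewrite inE /= !ind_and.
Qed.

Theorem theorem1p4 (R : realType) :
  exists beta0 D0 : R, [/\ 0 < beta0, 0 < D0 &
    forall gamma delta beta C : R,
      0 < gamma <= 1 -> 0 < delta <= 1 -> 0 < beta < beta0 ->
      D0 / (delta ^+ 2 * Num.sqrt beta * gamma) <= C ->
    exists n0 : nat, forall n : nat, (n0 <= n)%N ->
    forall (T : finType), #|T| = n -> forall H : sgraph T,
    exists G : sgraph T, [/\ subgraph G H, triangle_free G &
      forall A B : {set T}, [disjoint A & B] ->
        #|A|%:Z = Num.ceil (C * Num.sqrt (n%:R * ln n%:R)) ->
        #|B|%:Z = Num.ceil (C * Num.sqrt (n%:R * ln n%:R)) ->
        gamma * #|A|%:R * #|B|%:R <= (edges_between H A B)%:R ->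
        approx_eq delta (edges_between G A B)%:R
          (rho beta n * (edges_between H A B)%:R)]].
Proof.
(* [1000^-1] ensures [880 * beta <= 1]; 500 serves the jump bound and the final additive error. *)
exists 1000^-1, 500; split; rewrite ?invr_gt0 //.
move=> gamma delta beta C /andP[g0 g1] /andP[d0 d1] /andP[be0 be1] hC.
set b := Num.sqrt beta in hC.
have b0 : 0 < b by rewrite sqrtr_gt0.
have bb : b ^+ 2 = beta by rewrite sqr_sqrtr // ltW.
have k0 : 0 < delta ^+ 2 * gamma by rewrite mulr_gt0 // exprn_gt0.
have hC' : 500 <= C * (delta ^+ 2 * b * gamma).
  by move: hC; rewrite ler_pdivrMr // !mulr_gt0 // exprn_gt0.
have C0 : 0 <= C.
  by apply: le_trans hC; rewrite divr_ge0 // !mulr_ge0 ?exprn_ge0 // ltW.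
(* The sum of all the constants that [n ^ (1 / 40)] has to dominate. *)
have [n0 hn0] := expR_ln_large (8000 + (b^-1 + (delta ^+ 2 * gamma) ^- 2)).
exists n0 => n nn0 T cT H.
have [eL L1 hw Lw] := hn0 n nn0.
move: eL L1 hw Lw; set L := ln n%:R; set w := expR (L / 40) => eL L1 hw Lw.
have L0 : 0 <= L by apply: le_trans L1.
set l := Num.sqrt L.
have lL : l ^+ 2 = L by rewrite sqr_sqrtr.
have l1 : 1 <= l by rewrite -sqrtr1 ler_sqrt // (lt_le_trans ltr01).
have w0 : 0 < w by exact: expR_gt0.
have nE : n%:R = (w ^+ 20) ^+ 2 :> R.
  by rewrite -eL /w -exprM -expRM_natl; congr expR; field.
have sqn : Num.sqrt n%:R = w ^+ 20.
  by rewrite nE sqrtr_sqr ger0_norm // exprn_ge0 // ltW.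
have rhoE : rho beta n = b * l / w ^+ 20.
  rewrite /rho -/L.
  have -> : beta * L / n%:R = (b * l / w ^+ 20) ^+ 2.
    by rewrite nE -bb -lL; field; rewrite gt_eqF.
  rewrite sqrtr_sqr ger0_norm // divr_ge0 ?exprn_ge0 ?(ltW w0) //.
  by rewrite mulr_ge0 ?sqrtr_ge0.
set x := C * Num.sqrt (n%:R * L).
have xE : x = C * l * w ^+ 20.
  by rewrite /x sqrtrM ?ler0n // sqn -/l; ring.
have x0 : 0 <= x by rewrite mulr_ge0 ?sqrtr_ge0.
have c0 : 0 <= Num.ceil x.
  by rewrite -(ler_int R) (le_trans x0) //; case/andP: (ceil_itv x).
pose s := `|Num.ceil x|%N.
have sE : s%:Z = Num.ceil x by rewrite /s gez0_abs.
have sx : C * l * w ^+ 20 <= s%:R.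
  by rewrite -xE; case/andP: (ceil_itv x) => _; rewrite -sE.
have k2 : 0 < (delta ^+ 2 * gamma) ^- 2 by rewrite invr_gt0 exprn_gt0.
have bi : 0 < b^-1 by rewrite invr_gt0.
have w1 : 8000 <= w by apply: le_trans hw; rewrite lerDl addr_ge0 // ltW.
have w2 : b^-1 <= w.
  by apply: le_trans hw; rewrite addrCA lerDl addr_ge0 // ltW.
have w3 : (delta ^+ 2 * gamma) ^- 2 <= w.
  by apply: le_trans hw; rewrite addrA lerDr addr_ge0 // ltW.
have be2 : 880 * beta <= 1 by move: be0 be1; clear; lra.
have eL' : expR L = #|T|%:R by rewrite cT.
have [S IS hS] := process_asymptotics H g0 g1 d0 d1 b0 bb be2 hC' l1 lL eL'
  (erefl w) Lw w1 w2 w3 sx.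
(* [G] consists of the edges chosen by the end; pairs still open are dropped. *)
exists (SGraph (valid_Esym IS) (valid_Eirr IS)); split.
- exact: (valid_EH IS).
- by move=> [u [v [t [uv vt ut]]]]; exact: (valid_free IS ut uv vt).
move=> A B AB cA cB hAB.
have sA : #|A| = s by rewrite /s -cA.
have sB : #|B| = s by rewrite /s -cB.
move: hAB; rewrite /approx_eq !(edges_betweenE R _ AB) /= sA sB rhoE => hAB.
have := hS A B; rewrite /dense sA sB !eqxx /= expr2 mulrA => /(_ hAB).
rewrite ler_norml mulrBl mulrDl mul1r; set y := _ * between _ _ _ _ => /andP[h1 h2].
by apply/andP; split; move: h1 h2; clear; lra.
Qed.
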